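(* Let $\{(x_k,y_k,\lambda_k)\}_{k\ge1}$ be generated by the ZO-PDAPG iteration described in the context, with constants $\alpha,\beta,\gamma>0$ and smoothing parameters $\theta_1,\theta_2>0$. Let $\varepsilon>0$, let $\eta=\frac{(2\beta+\mu)(\beta+L)}{\mu\beta}$, and suppose $$\beta>3L,\qquad \alpha>\frac{L^3}{(L+\beta)^2}+\frac{2L(L+\beta)^2\eta^2}{\beta^2}+\frac{L^2}{\mu}+4L,\qquad \frac1\gamma>\frac{3\|B\|^2(L+\beta)^2\eta^2}{L\beta^2}+L+\frac{L^2}{\mu}.$$ Put $$D_1=\frac{\min\left\{\alpha-\frac{L^3}{(L+\beta)^2}-\frac{2L(L+\beta)^2\eta^2}{\beta^2}-\frac{L^2}{\mu}-4L,\ \beta-3L,\ \frac1\gamma-\frac{3\|B\|^2(L+\beta)^2\eta^2}{L\beta^2}-L-\frac{L^2}{\mu}\right\}}{\max\{2\beta^2+3L^2+3\|B\|^2,\ 3\alpha^2+3\|A\|^2,\ 3/\gamma^2\}},$$ $$\theta_1=\frac{\varepsilon\sqrt{D_1}}{\sqrt{d_xL(3D_1L+1)}},\qquad \theta_2=\frac{\varepsilon\sqrt{D_1}}{\sqrt{2D_1d_yL^2+\frac{[(L+\beta)^2+4L^2]d_yL}{2(L+\beta)^2}}}.$$ Define $T(\varepsilon):=\min\{k\ge1 : \|\nabla\hat{\mathcal G}^{\alpha,\beta,\gamma}(x_k,y_k,\lambda_k)\|\le\varepsilon\}$. Then $T(\varepsilon)$ is well-defined (such a $k$ exists) and $$T(\varepsilon)\le\frac{2D_2}{\varepsilon^2D_1},\qquad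 D_2:=S(x_1,y_1,\lambda_1)-\underline S,\qquad \underline S:=\inf_{\lambda\in\Lambda}\inf_{x\in\mathcal X}\inf_{y\in\mathcal Y}S(x,y,\lambda).$$ Moreover, for $k=T(\varepsilon)$ and every $i\in\{1,\dots,p\}$, $\max\{0,[Ax_k+By_k-c]_i\}\le\varepsilon$.
   Context: Problem: $\min_{x\in\mathcal X}\max_{y\in\mathcal Y,\ Ax+By\unlhd c}f(x,y)$, where $\unlhd$ is either $\le$ (componentwise) or $=$; $\mathcal X\subseteq\mathbb R^{d_x}$, $\mathcal Y\subseteq\mathbb R^{d_y}$ are nonempty, convex and compact; $A\in\mathbb R^{p\times d_x}$, $B\in\mathbb R^{p\times d_y}$, $c\in\mathbb R^p$. For every $x\in\mathcal X$ the set $\{y\in\mathcal Y:Ax+By\unlhd c\}$ is nonempty, and when $\unlhd$ is $\le$ there is, for every $x\in\mathcal X$, a point $y$ in the relative interior of $\mathcal Y$ with $Ax+By-c\le0$. $f:\mathbb R^{d_x}\times\mathbb R^{d_y}\to\mathbb R$ is continuously differentiable, and each of $\nabla_xf$, $\nabla_yf$ is $L$-Lipschitz ($L>0$) in $x$ for fixed $y$ and $L$-Lipschitz in $y$ for fixed $x$. For every $x\in\mathcal X$, $f(x,\cdot)$ is $\mu$-strongly concave on $\mathcal Y$ ($\mu>0$): $f(x,y')\le f(x,y)+\langle\nabla_yf(x,y),y'-y\rangle-\frac\mu2\|y'-y\|^2$. $\|\cdot\|$ is the Euclidean norm or induced matrix norm; $\mathcal P_{\mathcal Z}$ is Euclidean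 projection onto $\mathcal Z$. $\Lambda=\mathbb R_+^p$ if $\unlhd$ is $\le$, and $\Lambda=\mathbb R^p$ if $\unlhd$ is $=$. Set $\mathcal L(x,y,\lambda)=f(x,y)-\lambda^\top(Ax+By-c)$, $\Phi(x,\lambda)=\max_{y\in\mathcal Y}\mathcal L(x,y,\lambda)$, $S(x,y,\lambda)=2\Phi(x,\lambda)-\mathcal L(x,y,\lambda)$. Zeroth-order estimators, with standard bases $\{u_i\}$ of $\mathbb R^{d_x}$ and $\{v_i\}$ of $\mathbb R^{d_y}$: $\widehat\nabla_xf(x,y)=\sum_{i=1}^{d_x}\frac{f(x+\theta_1u_i,y)-f(x,y)}{\theta_1}u_i$, $\widehat\nabla_yf(x,y)=\sum_{i=1}^{d_y}\frac{f(x,y+\theta_2v_i)-f(x,y)}{\theta_2}v_i$, $\widehat\nabla_x\mathcal L=\widehat\nabla_xf-A^\top\lambda$, $\widehat\nabla_y\mathcal L=\widehat\nabla_yf-B^\top\lambda$. ZO-PDAPG iteration (constant parameters): from $(x_1,y_1,\lambda_1)\in\mathcal X\times\mathcal Y\times\Lambda$, for $k\ge1$, $y_{k+1}=\mathcal P_{\mathcal Y}(y_k+\frac1\beta\widehat\nabla_y\mathcal L(x_k,y_k,\lambda_k))$, $x_{k+1}=\mathcal P_{\mathcal X}(x_k-\frac1\alpha\widehat\nabla_x\mathcal L(x_k,y_{k+1},\lambda_k))$, $\lambda_{k+1}=\mathcal P_\Lambda(\lambda_k+\gamma(Ax_{k+1}+By_{k+1}-c))$. Stationarity gap: $\nabla\hat{\mathcal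 G}^{\alpha,\beta,\gamma}(x,y,\lambda)$ is the vector with the three blocks $\alpha(x-\mathcal P_{\mathcal X}(x-\frac1\alpha\nabla_x\mathcal L(x,y,\lambda)))$, $\beta(y-\mathcal P_{\mathcal Y}(y+\frac1\beta\nabla_y\mathcal L(x,y,\lambda)))$, $\frac1\gamma(\lambda-\mathcal P_\Lambda(\lambda-\gamma\nabla_\lambda\mathcal L(x,y,\lambda)))$.
   Formalization: The bound T(ε) ≤ 2D₂/(ε²D₁) is proved only when T(ε) > 1, i.e. T(ε) ≤ max{1, 2D₂/(ε²D₁)}; as written it fails when the initial point is already stationary and D₂ = 0 (e.g. f = −y²/2, A = B = c = 0, start at 0). *)

(* Defs.v *)
From HB Require Import structures.
From mathcomp Require Import all_boot all_order all_algebra.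
From mathcomp Require Import all_classical all_reals all_analysis.

Set Implicit Arguments.
Unset Strict Implicit.
Unset Printing Implicit Defensive.

Import Order.TTheory GRing.Theory Num.Theory.
Import numFieldNormedType.Exports.

Local Open Scope classical_set_scope.
Local Open Scope ring_scope.

(* The library norm on matrices is the sup norm, used below only through the
   topology (compact, differentiable, continuous); every quantitative notion
   uses the Euclidean norm enorm. *)
Section Euclidean.
Context {R : realType}.

Definition dotp n (u v : 'cV[R]_n) : R := \sum_i u i 0 * v i 0.

Definition enorm n (u : 'cV[R]_n) : R := Num.sqrt (dotp u u).

Definition opnorm m n (M : 'M[R]_(m, n)) : R :=
  sup [set enorm (M *m v) | v in [set v | enorm v <= 1]].

(* For Z nonempty, closed and convex the minimizer exists and is unique, so the
   default 0 of xget plays no role. *)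
Definition proj n (Z : set 'cV[R]_n) (v : 'cV[R]_n) : 'cV[R]_n :=
  xget 0 [set z | Z z /\ forall w, Z w -> enorm (v - z) <= enorm (v - w)].

Definition affine_hull n (Z : set 'cV[R]_n) : set 'cV[R]_n :=
  [set v | exists (k : nat) (w : 'I_k -> R) (z : 'I_k -> 'cV[R]_n),
     [/\ forall i, Z (z i), \sum_i w i = 1 & v = \sum_i w i *: z i]].

Definition rel_interior n (Z : set 'cV[R]_n) : set 'cV[R]_n :=
  [set v | Z v /\ exists2 r, 0 < r &
     forall w, affine_hull Z w -> enorm (w - v) < r -> Z w].

Definition grad n (g : 'cV[R]_n -> R) (v : 'cV[R]_n) : 'cV[R]_n :=
  \col_i 'D_(delta_mx i 0) g v.

Definition C1 m n (f : 'cV[R]_m -> 'cV[R]_n -> R) : Prop :=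
  let F := fun z : 'cV[R]_m * 'cV[R]_n => f z.1 z.2 in
  (forall z, differentiable F z) /\
  (forall v, continuous (fun z => 'd F z v)).

Definition eLipschitz m n (L : R) (g : 'cV[R]_m -> 'cV[R]_n) : Prop :=
  forall u v, enorm (g u - g v) <= L * enorm (u - v).

End Euclidean.

Section Smooth.
Context {R : realType} {dx dy : nat} (f : 'cV[R]_dx -> 'cV[R]_dy -> R).

Definition gradx x y := grad (fun x' => f x' y) x.

Definition grady x y := grad (fun y' => f x y') y.

Definition smooth (L : R) : Prop :=
  [/\ forall y, eLipschitz L (fun x => gradx x y),
      forall x, eLipschitz L (fun y => gradx x y),
      forall y, eLipschitz L (fun x => grady x y)
    & forall x, eLipschitz L (fun y => grady x y)].

Definition strongly_concave_y (X : set 'cV[R]_dx) (Y : set 'cV[R]_dy)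
    (mu : R) : Prop :=
  forall x y y', X x -> Y y -> Y y' ->
    f x y' <= f x y + dotp (grady x y) (y' - y) - mu / 2 * enorm (y' - y) ^+ 2.

Definition zgradx (theta : R) x y : 'cV[R]_dx :=
  \sum_i ((f (x + theta *: delta_mx i 0) y - f x y) / theta) *: delta_mx i 0.

Definition zgrady (theta : R) x y : 'cV[R]_dy :=
  \sum_i ((f x (y + theta *: delta_mx i 0) - f x y) / theta) *: delta_mx i 0.

End Smooth.

(* The relation between A x + B y and c. *)
Inductive sense := LeSense | EqSense.

Section Problem.
Context {R : realType} {dx dy p : nat}.
Variables (f : 'cV[R]_dx -> 'cV[R]_dy -> R).
Variables (A : 'M[R]_(p, dx)) (B : 'M[R]_(p, dy)) (c : 'cV[R]_p).
Variables (s : sense) (X : set 'cV[R]_dx) (Y : set 'cV[R]_dy).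

Definition resid x y : 'cV[R]_p := A *m x + B *m y - c.

Definition feasible x y : Prop :=
  match s with
  | LeSense => forall i, resid x y i 0 <= 0
  | EqSense => resid x y = 0
  end.

Definition slater : Prop :=
  s = LeSense -> forall x, X x ->
    exists2 y, rel_interior Y y & forall i, resid x y i 0 <= 0.

Definition Lam : set 'cV[R]_p :=
  match s with
  | LeSense => [set l | forall i, 0 <= l i 0]
  | EqSense => setT
  end.

Definition Lag x y (l : 'cV[R]_p) : R := f x y - dotp l (resid x y).

(* Y is compact and f continuous, so this supremum is the maximum over Y. *)
Definition Phi x l : R := sup [set Lag x y l | y in Y].

Definition Spot x y l : R := 2 * Phi x l - Lag x y l.

(* Spot x y l >= Phi x l >= f x y' for every y' feasible for x, so all three
   infima are over sets bounded below whenever the problem is feasible. *)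
Definition S_inf : R :=
  inf [set inf [set inf [set Spot x y l | y in Y] | x in X] | l in Lam].

Definition zgradx_Lag (theta : R) x y (l : 'cV[R]_p) :=
  zgradx f theta x y - A^T *m l.

Definition zgrady_Lag (theta : R) x y (l : 'cV[R]_p) :=
  zgrady f theta x y - B^T *m l.

(* Iterates are numbered from 1; the values at index 0 are irrelevant. *)
Definition zo_pdapg (alpha beta gamma theta1 theta2 : R)
    (x : nat -> 'cV[R]_dx) (y : nat -> 'cV[R]_dy) (l : nat -> 'cV[R]_p) : Prop :=
  [/\ X (x 1%N), Y (y 1%N), Lam (l 1%N) & forall k, (0 < k)%N ->
  [/\ y k.+1 = proj Y (y k + beta^-1 *: zgrady_Lag theta2 (x k) (y k) (l k)),
      x k.+1 = proj X (x k - alpha^-1 *: zgradx_Lag theta1 (x k) (y k.+1) (l k))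
    & l k.+1 = proj Lam (l k + gamma *: resid (x k.+1) (y k.+1))]].

Definition gap (alpha beta gamma : R) x y l : 'cV[R]_(dx + (dy + p)) :=
  col_mx (alpha *: (x - proj X (x - alpha^-1 *: grad (fun x' => Lag x' y l) x)))
 (col_mx (beta *: (y - proj Y (y + beta^-1 *: grad (fun y' => Lag x y' l) y)))
         (gamma^-1 *: (l - proj Lam (l - gamma *: grad (fun l' => Lag x y l') l)))).

End Problem.

Section Constants.
Context {R : realType}.
Variables (L mu alpha beta gamma nA nB : R).

Definition eta : R := (2 * beta + mu) * (beta + L) / (mu * beta).

Definition alpha_bound : R :=
  L ^+ 3 / (L + beta) ^+ 2
  + 2 * L * (L + beta) ^+ 2 * eta ^+ 2 / beta ^+ 2 + L ^+ 2 / mu + 4 * L.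

Definition invgamma_bound : R :=
  3 * nB ^+ 2 * (L + beta) ^+ 2 * eta ^+ 2 / (L * beta ^+ 2) + L + L ^+ 2 / mu.

Definition D1_const : R :=
  Num.min (alpha - alpha_bound)
    (Num.min (beta - 3 * L) (gamma^-1 - invgamma_bound))
  / Num.max (2 * beta ^+ 2 + 3 * L ^+ 2 + 3 * nB ^+ 2)
      (Num.max (3 * alpha ^+ 2 + 3 * nA ^+ 2) (3 / gamma ^+ 2)).

End Constants.

Definition is_first (P : nat -> Prop) (T : nat) : Prop :=
  [/\ (0 < T)%N, P T & forall k, (0 < k)%N -> P k -> (T <= k)%N].

(* Main.v *)
Require Import Defs.
From HB Require Import structures.
From mathcomp Require Import all_boot all_order all_algebra.
From mathcomp Require Import all_classical all_reals all_analysis.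
From mathcomp Require Import ring lra.

Set Implicit Arguments.
Unset Strict Implicit.
Unset Printing Implicit Defensive.

Import Order.TTheory GRing.Theory Num.Theory.
Import numFieldNormedType.Exports.

Local Open Scope classical_set_scope.
Local Open Scope ring_scope.

(** The potential is [Spot x y l = 2 * Phi x l - Lag x y l].  Along one
    iteration from [(x, y, l)] to [(x', y', l')] it decreases by a weighted sum
    of the squared lengths of the three moves, up to the errors of the two
    difference quotients, and those lengths control the stationarity gap at
    [(x, y, l)]; as [Spot] is bounded below, the gap cannot stay above [eps] for
    long.

    Decrease.  Let [ys] maximize [Lag x' _ l'] on [Y].  Since
    [Phi x' l' = Lag x' ys l'] and [Phi x l >= Lag x ys l], the variation of
    [Phi] is at most a variation of [Lag] with the second argument frozen at
    [ys].  Replacing [ys] by [y'] in the gradients costs a multiple of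
    [D = enorm (ys - y')]; what remains is one copy of each partial gradient of
    [Lag] against the corresponding move, and each of the three projections
    makes that product at least the inverse step size times the squared move
    ([potential_step]).  The distance [D] is itself bounded by the moves and the
    error in [y], because [f x'] is strongly concave and both [ys] and [y']
    satisfy a variational inequality ([maximizer_distance]).  Young's inequality then
    absorbs the coupling terms ([coupling_le]), with [kappa], the square of
    [2 * (L + beta) / mu], as the price paid by the moves of [x] and [l].

    Gap.  Nonexpansiveness of the projections bounds each block of the gap by a
    linear combination of the moves and of the estimation errors ([gapx_le],
    [gapy_le], [gapl_le]).

    Counting steps.  If the gap exceeds [eps] at the indices [1 .. N], then the
    bound to prove concerns [T = N.+1], so a loss of
    [D1 * eps ^+ 2 / 2] of potential per iteration would give only
    [N <= 2 * D2 / (eps ^+ 2 * D1)], one step short.  The lemma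
    [potential_decrease] gives the loss [D1 * eps ^+ 2], and
    [N.+1 <= 2 * N] closes the argument for [T > 1].  This factor is
    available for two different reasons.  If [Y] has two points then
    [mu <= L] ([modulus_le]), and the lower bounds on [alpha] and [gamma^-1]
    make the step sizes so small that [2 * D1 * gap ^+ 2] is still covered
    ([gap_potential]).  If [Y] is a single point, all terms in [y] vanish, there
    are fewer summands to split, and [4 / 3 * D1 * gap ^+ 2] is covered with
    only the [x]-error to pay ([gap_potential_singleton]).

    Feasibility.  The multiplier block of the gap dominates every violated
    constraint ([violation_le_multiplier_gap]). *)

Local Notation proj := Defs.proj.
Local Notation eta := Defs.eta.

(** * Euclidean geometry *)

Section InnerProduct.
Context {R : realType}.

Lemma dotpC n (u v : 'cV[R]_n) : dotp u v = dotp v u.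
Proof. by apply: eq_bigr => i _; rewrite mulrC. Qed.

Lemma dotpDr n (u v w : 'cV[R]_n) : dotp u (v + w) = dotp u v + dotp u w.
Proof. by rewrite -big_split; apply: eq_bigr => i _; rewrite mxE mulrDr. Qed.

Lemma dotpZr n a (u v : 'cV[R]_n) : dotp u (a *: v) = a * dotp u v.
Proof. by rewrite mulr_sumr; apply: eq_bigr => i _; rewrite mxE mulrCA. Qed.

Lemma dotpNr n (u v : 'cV[R]_n) : dotp u (- v) = - dotp u v.
Proof. by rewrite -scaleN1r dotpZr mulN1r. Qed.

Lemma dotpBr n (u v w : 'cV[R]_n) : dotp u (v - w) = dotp u v - dotp u w.
Proof. by rewrite dotpDr dotpNr. Qed.

Lemma dotpDl n (u v w : 'cV[R]_n) : dotp (u + v) w = dotp u w + dotp v w.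
Proof. by rewrite !(dotpC _ w) dotpDr. Qed.

Lemma dotpZl n a (u v : 'cV[R]_n) : dotp (a *: u) v = a * dotp u v.
Proof. by rewrite !(dotpC _ v) dotpZr. Qed.

Lemma dotpNl n (u v : 'cV[R]_n) : dotp (- u) v = - dotp u v.
Proof. by rewrite !(dotpC _ v) dotpNr. Qed.

Lemma dotpBl n (u v w : 'cV[R]_n) : dotp (u - v) w = dotp u w - dotp v w.
Proof. by rewrite dotpDl dotpNl. Qed.

Definition dotp_linE := (dotpDr, dotpDl, dotpBr, dotpBl, dotpNr, dotpNl,
  dotpZr, dotpZl).

Lemma dotp_trmx m n (M : 'M[R]_(m, n)) u v :
  dotp (M^T *m u) v = dotp u (M *m v).
Proof.
rewrite /dotp; under eq_bigr do rewrite mxE mulr_suml.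
rewrite exchange_big; apply: eq_bigr => i _; rewrite mxE mulr_sumr.
by apply: eq_bigr => j _; rewrite mxE; ring.
Qed.

Lemma dotp_ge0 n (u : 'cV[R]_n) : 0 <= dotp u u.
Proof. by apply: sumr_ge0 => i _; rewrite -expr2 sqr_ge0. Qed.

Lemma enorm_ge0 n (u : 'cV[R]_n) : 0 <= enorm u.
Proof. exact: sqrtr_ge0. Qed.

Lemma enorm_sqr n (u : 'cV[R]_n) : enorm u ^+ 2 = dotp u u.
Proof. by rewrite sqr_sqrtr // dotp_ge0. Qed.

Lemma enorm0 n : enorm (0 : 'cV[R]_n) = 0.
Proof.
rewrite /enorm (_ : dotp _ _ = 0) ?sqrtr0// /dotp big1// => i _.
by rewrite mxE mul0r.
Qed.

Lemma enorm_eq0 n (u : 'cV[R]_n) : enorm u = 0 -> u = 0.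
Proof.
move=> /(congr1 (fun a => a ^+ 2)); rewrite enorm_sqr expr0n /= => /eqP.
rewrite psumr_eq0 => [/allP u0|i _]; last by rewrite -expr2 sqr_ge0.
apply/matrixP => i j; rewrite mxE ord1; apply/eqP.
by have := u0 i (mem_index_enum i); rewrite mulf_eq0 orbb.
Qed.

Lemma enormZ n a (u : 'cV[R]_n) : enorm (a *: u) = `|a| * enorm u.
Proof.
rewrite /enorm dotpZl dotpZr mulrA -expr2 sqrtrM ?sqr_ge0//.
by rewrite sqrtr_sqr.
Qed.

Lemma enormN n (u : 'cV[R]_n) : enorm (- u) = enorm u.
Proof. by rewrite /enorm !dotp_linE opprK. Qed.

Lemma enormBC n (u v : 'cV[R]_n) : enorm (u - v) = enorm (v - u).
Proof. by rewrite -enormN opprB. Qed.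

Lemma dotp_le n (u v : 'cV[R]_n) : dotp u v <= enorm u * enorm v.
Proof.
have [v0|v0] := eqVneq (enorm v) 0.
  rewrite v0 mulr0 (enorm_eq0 v0) /dotp big1// => i _.
  by rewrite [X in _ * X]mxE mulr0.
have [u0|u0] := eqVneq (enorm u) 0.
  rewrite u0 mul0r (enorm_eq0 u0) /dotp big1// => i _.
  by rewrite [X in X * _]mxE mul0r.
have up : 0 < enorm u by rewrite lt_def u0 enorm_ge0.
have vp : 0 < enorm v by rewrite lt_def v0 enorm_ge0.
(* Expanding gives the inequality multiplied by 2 * enorm u * enorm v. *)
have := dotp_ge0 (enorm v *: u - enorm u *: v).
rewrite !dotp_linE -!enorm_sqr (dotpC v u) => h.
have {h} : 0 <= (enorm u * enorm v) * (enorm u * enorm v - dotp u v) by lra.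
by rewrite pmulr_rge0 ?mulr_gt0// subr_ge0.
Qed.

Lemma enormD n (u v : 'cV[R]_n) : enorm (u + v) <= enorm u + enorm v.
Proof.
rewrite -(@ler_pXn2r _ 2) ?nnegrE ?addr_ge0 ?enorm_ge0//.
rewrite enorm_sqr !dotp_linE -!enorm_sqr (dotpC v u).
by have := dotp_le u v; lra.
Qed.

Lemma enorm_le_sqr n (u : 'cV[R]_n) b : 0 <= b -> enorm u ^+ 2 <= b ^+ 2 ->
  enorm u <= b.
Proof. by move=> b0; rewrite ler_pXn2r ?nnegrE ?enorm_ge0. Qed.

Lemma enorm_sqr_le n (u : 'cV[R]_n) b : enorm u <= b -> enorm u ^+ 2 <= b ^+ 2.
Proof.
move=> ub; have u0 := enorm_ge0 u.
by rewrite ler_pXn2r ?nnegrE ?(le_trans u0 ub).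
Qed.

Lemma coord_le_enorm n (u : 'cV[R]_n) i : `|u i 0| <= enorm u.
Proof.
rewrite -(@ler_pXn2r _ 2) ?nnegrE ?enorm_ge0 ?normr_ge0//.
rewrite enorm_sqr /dotp (bigD1 i)//= real_normK ?num_real// expr2 lerDl.
by apply: sumr_ge0 => j _; rewrite -expr2 sqr_ge0.
Qed.

Lemma dotp_delta n (u : 'cV[R]_n) i : dotp u (delta_mx i 0) = u i 0.
Proof.
rewrite /dotp (bigD1 i)//= mxE !eqxx mulr1 big1 ?addr0// => j ji.
by rewrite mxE (negbTE ji) mulr0.
Qed.

Lemma enorm_delta n (i : 'I_n) : enorm (delta_mx i 0 : 'cV[R]_n) = 1.
Proof. by rewrite /enorm dotp_delta mxE !eqxx sqrtr1. Qed.

Lemma enorm_col_mx m n (u : 'cV[R]_m) (v : 'cV[R]_n) :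
  enorm (col_mx u v) ^+ 2 = enorm u ^+ 2 + enorm v ^+ 2.
Proof.
rewrite !enorm_sqr /dotp big_split_ord /=.
by congr (_ + _); apply: eq_bigr => i _; rewrite ?col_mxEu ?col_mxEd.
Qed.

(** The supremum defining the operator norm is finite: every entry of [M *m v]
    is an inner product with a row of [M], bounded by Cauchy-Schwarz. *)
Lemma opnorm_has_sup m n (M : 'M[R]_(m, n)) :
  has_sup [set enorm (M *m v) | v in [set v | enorm v <= 1]].
Proof.
split; first by exists (enorm (M *m 0)), 0 => //=; rewrite enorm0.
pose r i := (row i M)^T.
have r0 : 0 <= \sum_i enorm (r i) ^+ 2.
  by apply: sumr_ge0 => i _; rewrite sqr_ge0.
exists (Num.sqrt (\sum_i enorm (r i) ^+ 2)) => _ [v /= v1 <-].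
apply: enorm_le_sqr; rewrite ?sqrtr_ge0// enorm_sqr sqr_sqrtr//.
apply: ler_sum => i _; have -> : (M *m v) i 0 = dotp (r i) v.
  by rewrite mxE; apply: eq_bigr => j _; rewrite !mxE.
rewrite -expr2 -real_normK ?num_real// ler_pXn2r ?nnegrE ?enorm_ge0//.
apply: (@le_trans _ _ (enorm (r i) * enorm v)); last first.
  by rewrite ler_piMr ?enorm_ge0.
by rewrite ler_norml dotp_le andbT lerNl -dotpNr -(enormN v) dotp_le.
Qed.

Lemma opnorm_ge0 m n (M : 'M[R]_(m, n)) : 0 <= opnorm M.
Proof.
apply: le_trans (ub_le_sup (opnorm_has_sup M).2 _); last first.
  by exists 0 => //=; rewrite enorm0.
exact: enorm_ge0.
Qed.

Lemma opnorm_le m n (M : 'M[R]_(m, n)) v : enorm (M *m v) <= opnorm M * enorm v.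
Proof.
have [v0|v0] := eqVneq (enorm v) 0.
  by rewrite (enorm_eq0 v0) mulmx0 !enorm0 mulr0.
have vp : 0 < enorm v by rewrite lt_def v0 enorm_ge0.
rewrite -ler_pdivrMr//; have := ub_le_sup (opnorm_has_sup M).2; apply.
exists ((enorm v)^-1 *: v) => /=.
  by rewrite enormZ ger0_norm ?invr_ge0 ?enorm_ge0// mulVf.
by rewrite -scalemxAr enormZ ger0_norm ?invr_ge0 ?enorm_ge0// mulrC.
Qed.

End InnerProduct.

(** * Projections *)

Section Projection.
Context {R : realType}.

(** First-order optimality: a displacement of size [t] changes the objective by
    [t * a] up to a quadratic remainder, and [t] may be taken arbitrarily small. *)
Lemma first_order_le0 (a b : R) :
  (forall t, 0 < t -> t <= 1 -> t * a <= t ^+ 2 * b) -> a <= 0.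
Proof.
move=> h; rewrite leNgt; apply/negP => a0.
have ab : a <= b by have := h 1 ltr01 (lexx _); rewrite expr1n !mul1r.
have b0 : 0 < b by exact: lt_le_trans ab.
(* At t = a / (2 * b) the hypothesis reads a <= a / 2. *)
have t0 : 0 < a / (2 * b) by rewrite divr_gt0// mulr_gt0.
have t1 : a / (2 * b) <= 1 by rewrite ler_pdivrMr ?mulr_gt0//; lra.
have := h _ t0 t1; rewrite expr2 -mulrA ler_pM2l//.
have -> : a / (2 * b) * b = a / 2 by field; rewrite gt_eqF.
by lra.
Qed.

Definition segment_closed n (Z : set 'cV[R]_n) := forall z w t,
  Z z -> Z w -> 0 <= t -> t <= 1 -> Z (z + t *: (w - z)).

Lemma convex_segment_closed n (Z : set 'cV[R]_n) :
  convex_set Z -> segment_closed Z.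
Proof.
move=> cZ z w t Zz Zw t0 t1.
have := cZ w z (Itv01 t0 t1) (mem_set Zw) (mem_set Zz); rewrite inE.
congr (Z _); rewrite /conv /= /isConvexSpace.conv /= /unstable.onem.
by rewrite scalerBr scalerBl scale1r [LHS]addrC addrAC addrA.
Qed.

(** The existence of nearest points is kept separate from its cause, since the
    cone of multipliers is convex but not compact. *)
Definition projectable n (Z : set 'cV[R]_n) := segment_closed Z /\
  forall v, exists z, Z z /\ forall w, Z w -> enorm (v - z) <= enorm (v - w).

Lemma continuous_coord n (i : 'I_n) : continuous (fun v : 'cV[R]_n => v i 0).
Proof. exact: coord_continuous. Qed.

Lemma dotp_continuous (T : topologicalType) n (g h : T -> 'cV[R]_n) :
  continuous g -> continuous h -> continuous (fun z => dotp (g z) (h z)).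
Proof.
move=> cg ch z; apply: cvg_big => [|i _].
  exact: add_continuous.
apply: cvgM.
  exact: (continuous_comp (@cg z) (@continuous_coord _ i (g z))).
exact: (continuous_comp (@ch z) (@continuous_coord _ i (h z))).
Qed.

Lemma compact_projectable n (Z : set 'cV[R]_n) : Z !=set0 -> compact Z ->
  convex_set Z -> projectable Z.
Proof.
move=> Z0 cZ /convex_segment_closed sZ; split => // v.
have cB : continuous (fun z : 'cV[R]_n => v - z).
  move=> z; apply: (@differentiable_continuous R 'cV[R]_n 'cV[R]_n).
  exact: differentiableB.
have cd := dotp_continuous cB cB.
have [c] := compact_EVT_min Z0 cZ (continuous_subspaceT cd).
rewrite inE => Zc mc; exists c; split=> // w Zw.
by rewrite ler_sqrt ?dotp_ge0// mc ?inE.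
Qed.

Section Projectable.
Context {n : nat} {Z : set 'cV[R]_n}.
Hypothesis pZ : projectable Z.

Lemma proj_min v : Z (proj Z v) /\
  forall w, Z w -> enorm (v - proj Z v) <= enorm (v - w).
Proof.
have [z Zz] := pZ.2 v.
by have := @xgetPex _ 0 [set z | Z z /\ forall w, Z w ->
  enorm (v - z) <= enorm (v - w)] (ex_intro _ z Zz).
Qed.

Lemma proj_in v : Z (proj Z v).
Proof. by have [] := proj_min v. Qed.

(** The segment from the projection [q] to [w] stays in [Z], so the squared
    distance to [v] cannot decrease to first order along it. *)
Lemma proj_VI v w : Z w -> dotp (v - proj Z v) (w - proj Z v) <= 0.
Proof.
move=> Zw; have [Zp mp] := proj_min v; set q := proj Z v in Zp mp *.
suff : 2 * dotp (v - q) (w - q) <= 0 by lra.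
apply: (@first_order_le0 _ (enorm (w - q) ^+ 2)) => t t0 t1.
have h := mp _ (pZ.1 q w t Zp Zw (ltW t0) t1).
have {h} : enorm (v - q) ^+ 2 <= enorm (v - (q + t *: (w - q))) ^+ 2.
  by rewrite ler_pXn2r ?nnegrE ?enorm_ge0.
rewrite opprD addrA; move: (v - q) (w - q) => a b.
by rewrite !enorm_sqr !dotp_linE (dotpC b a) => h; lra.
Qed.

(** Adding the variational inequalities of the two projections, each tested at
    the other one, gives [enorm d ^+ 2 <= dotp (v - w) d] for their
    difference [d]. *)
Lemma proj_nonexpansive v w : enorm (proj Z v - proj Z w) <= enorm (v - w).
Proof.
set d := proj Z v - proj Z w.
have [->|d0] := eqVneq (enorm d) 0; first exact: enorm_ge0.
have dp : 0 < enorm d by rewrite lt_def d0 enorm_ge0.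
rewrite -(ler_pM2r dp); apply: le_trans (dotp_le _ _).
rewrite -expr2 enorm_sqr.
have := proj_VI v (proj_in w); have := proj_VI w (proj_in v).
by rewrite /d !dotp_linE => h1 h2; lra.
Qed.

End Projectable.
End Projection.

(** Optimality of a projected step of length [t^-1] along [g], with the step
    length cleared. *)
Lemma proj_step_VI {R : realType} n (Z : set 'cV[R]_n) (t : R) z g w q :
  projectable Z -> 0 < t -> q = proj Z (z + t^-1 *: g) -> Z w ->
  dotp (g + t *: (z - q)) (w - q) <= 0.
Proof.
move=> pZ t0 qE Zw; have -> : g + t *: (z - q) = t *: (z + t^-1 *: g - q).
  rewrite [z + t^-1 *: _]addrC -addrA [RHS]scalerDr scalerA.
  by rewrite mulfV ?gt_eqF// scale1r.
by rewrite dotpZl pmulr_rle0// qE proj_VI.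
Qed.

Lemma proj_step_ascent {R : realType} n (Z : set 'cV[R]_n) (t : R) z g q :
  projectable Z -> 0 < t -> q = proj Z (z + t^-1 *: g) -> Z z ->
  t * enorm (q - z) ^+ 2 <= dotp g (q - z).
Proof.
move=> pZ t0 qE Zz; have := proj_step_VI pZ t0 qE Zz.
by rewrite -(opprB q z) scalerN dotpNr dotpBl dotpZl -enorm_sqr; lra.
Qed.

(** * Gradients and difference quotients *)

Section Gradient.
Context {R : realType}.

Lemma sum_delta_coord n (a : 'I_n -> R) i :
  (\sum_j a j *: delta_mx j 0 : 'cV[R]_n) i 0 = a i.
Proof.
rewrite summxE (bigD1 i)//= !mxE !eqxx mulr1 big1 ?addr0// => j ji.
by rewrite !mxE eq_sym (negbTE ji) mulr0.
Qed.

Lemma dotp_grad n (g : 'cV[R]_n -> R) u h : differentiable g u ->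
  dotp (grad g u) h = 'd g u h.
Proof.
move=> dg; have -> : h = \sum_i h i 0 *: delta_mx i 0.
  by rewrite {1}(matrix_sum_delta h); apply: eq_bigr => i _; rewrite big_ord1.
rewrite linear_sum /dotp; apply: eq_bigr => i _; rewrite linearZ /=.
by rewrite mxE deriveE// mulrC sum_delta_coord.
Qed.

Lemma is_derive_line n (g : 'cV[R]_n -> R) (u h : 'cV[R]_n) (t : R) :
  differentiable g (u + t *: h) ->
  is_derive t 1 (fun s => g (u + s *: h)) (dotp (grad g (u + t *: h)) h).
Proof.
move=> dg; rewrite dotp_grad// -deriveE//.
(* Both derivatives are limits of the same difference quotient. *)
have E : (fun s : R => s^-1 *: (((fun s' => g (u + s' *: h)) \o shift t)
      (s *: (1 : R)) - g (u + t *: h))) =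
    (fun s => s^-1 *: ((g \o shift (u + t *: h)) (s *: h) - g (u + t *: h))).
  apply/funext => s /=; congr (_ *: (g _ - _)).
  by rewrite [s *: 1]mulr1 scalerDl addrCA.
split; last by rewrite /derive E.
by rewrite /derivable E; exact: diff_derivable.
Qed.

(** The mean value theorem applied to [g] on the segment minus the quadratic
    [L / 2 * s ^+ 2 * enorm h ^+ 2]: the derivative of the difference at [c] is at
    most [dotp (grad g u) h], since the gradient moves by at most
    [L * c * enorm h]. *)
Lemma descent_upper n (g : 'cV[R]_n -> R) L u v :
  (forall z, differentiable g z) -> eLipschitz L (grad g) ->
  g v <= g u + dotp (grad g u) (v - u) + L / 2 * enorm (v - u) ^+ 2.
Proof.
move=> dg lg; set h := v - u.
pose psi := (fun s : R => g (u + s *: h))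
  - (fun s => (L / 2 * enorm h ^+ 2) *: s ^+ 2).
have dpsi (t : R) : is_derive t 1 psi
    (dotp (grad g (u + t *: h)) h - L * t * enorm h ^+ 2).
  apply: is_deriveB; first exact: is_derive_line.
  by apply: is_derive_eq; rewrite /GRing.scale /= !mulr1; field.
have cpsi : continuous psi.
  move=> x; apply: differentiable_continuous.
  by apply/derivable1_diffP; have [] := dpsi x.
have [c] := MVT ltr01 (fun t _ => dpsi t) (continuous_subspaceT cpsi).
rewrite in_itv /= => /andP[c0 c1].
have -> : psi 1 = g v - L / 2 * enorm h ^+ 2.
  rewrite /psi !fctE scale1r /h subrKC; congr (_ - _).
  by rewrite /GRing.scale /= expr1n mulr1.
have -> : psi 0 = g u.
  by rewrite /psi !fctE scale0r addr0 /GRing.scale /= expr0n mulr0 subr0.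
rewrite subr0 mulr1 => e.
have : dotp (grad g (u + c *: h) - grad g u) h <= L * c * enorm h ^+ 2.
  apply: le_trans (dotp_le _ _) _; rewrite expr2 mulrA ler_wpM2r ?enorm_ge0//.
  apply: le_trans (lg _ _) _.
  by rewrite addrAC subrr add0r enormZ gtr0_norm// mulrA.
by rewrite dotpBl; lra.
Qed.

Lemma gradN n (g : 'cV[R]_n -> R) u : differentiable g u ->
  grad (- g) u = - grad g u.
Proof.
move=> dg; apply/matrixP => i j; rewrite !mxE deriveN//.
exact: diff_derivable.
Qed.

Lemma descent_lower n (g : 'cV[R]_n -> R) L u v :
  (forall z, differentiable g z) -> eLipschitz L (grad g) ->
  g u + dotp (grad g u) (v - u) - L / 2 * enorm (v - u) ^+ 2 <= g v.
Proof.
move=> dg lg.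
have := @descent_upper n (- g) L u v (fun z => differentiableN (dg z)).
rewrite gradN// dotpNl !fctE => h.
have : - g v <= - g u - dotp (grad g u) (v - u) + L / 2 * enorm (v - u) ^+ 2.
  apply: h => a b; rewrite !gradN// -opprD enormN; exact: lg.
by lra.
Qed.

(** By the two descent inequalities each coordinate of the error is at most
    [L * theta / 2] in absolute value. *)
Lemma forward_difference_error n (g : 'cV[R]_n -> R) L theta u :
  0 < theta -> (forall z, differentiable g z) -> eLipschitz L (grad g) ->
  enorm (\sum_i ((g (u + theta *: delta_mx i 0) - g u) / theta) *: delta_mx i 0
         - grad g u) ^+ 2 <= n%:R * L ^+ 2 * theta ^+ 2 / 4.
Proof.
move=> t0 dg lg; rewrite enorm_sqr /dotp.
have -> : n%:R * L ^+ 2 * theta ^+ 2 / 4 = \sum_(i < n) (L * theta / 2) ^+ 2.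
  by rewrite sumr_const card_ord -mulr_natl; field.
apply: ler_sum => i _; rewrite mxE [X in _ + X]mxE sum_delta_coord.
have := descent_upper u (u + theta *: delta_mx i 0) dg lg.
have := descent_lower u (u + theta *: delta_mx i 0) dg lg.
rewrite [u + _ - u]addrC addKr enormZ enorm_delta mulr1 dotpZr dotp_delta.
rewrite gtr0_norm//.
move: (grad g u i 0) (g (u + _)) (g u) => G d e h1 h2; set q := _ / theta - G.
have qE : theta * q = d - e - theta * G by rewrite /q; field; rewrite gt_eqF.
have q1 : q <= L * theta / 2 by rewrite -(ler_pM2l t0) qE; lra.
have q2 : - q <= L * theta / 2 by rewrite -(ler_pM2l t0) mulrN qE; lra.
nra.
Qed.

Lemma differentiable_affine n (w : 'cV[R]_n) (k : R) u :
  differentiable (fun v => dotp w v + k) u.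
Proof.
apply: differentiableD => //.
have -> : dotp w = \sum_i w i 0 *: (fun v : 'cV[R]_n => v i 0).
  by apply/funext => v; rewrite fct_sumE.
apply: differentiable_sum => i.
by apply: differentiableZ; exact: differentiable_coord.
Qed.

Lemma grad_affine n (g : 'cV[R]_n -> R) (w : 'cV[R]_n) k u :
  (forall v, g v = dotp w v + k) -> grad g u = w.
Proof.
move=> gE; apply/matrixP => i j; rewrite ord1 mxE.
apply: cvg_lim => //; apply: cvg_near_cst.
near=> t; rewrite /= !gE dotpDr dotpZr dotp_delta.
rewrite -[_ + k]addrA addrK /GRing.scale /= mulKf//.
near: t; exact: nbhs_dnbhs_neq.
Unshelve. all: by end_near. Qed.

Lemma gradB_affine n (g h : 'cV[R]_n -> R) (w : 'cV[R]_n) k u :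
  differentiable g u -> (forall v, h v = g v - (dotp w v + k)) ->
  grad h u = grad g u - w.
Proof.
move=> dg hE.
have -> : h = g - (fun z => dotp w z + k) by apply/funext => v; rewrite hE.
apply/matrixP => i j; rewrite ord1 !mxE deriveB//; last 2 first.
- exact: diff_derivable.
- by apply: diff_derivable; exact: differentiable_affine.
congr (_ - _).
have := @grad_affine _ (fun z => dotp w z + k) w k u (fun=> erefl).
by move=> /matrixP /(_ i 0); rewrite mxE.
Qed.

End Gradient.

Section Partial.
Context {R : realType} {m n : nat} (f : 'cV[R]_m -> 'cV[R]_n -> R).
Hypothesis f_C1 : C1 f.

Lemma C1_differentiablex y x : differentiable (f ^~ y) x.
Proof.
apply: (@differentiable_comp _ _ _ _ (fun x => (x, y)) (fun z => f z.1 z.2)).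
  exact: differentiable_pair.
exact: f_C1.1.
Qed.

Lemma C1_differentiabley x y : differentiable (f x) y.
Proof.
apply: (@differentiable_comp _ _ _ _ (fun y => (x, y)) (fun z => f z.1 z.2)).
  exact: differentiable_pair.
exact: f_C1.1.
Qed.

Lemma C1_continuous : continuous (fun z : 'cV[R]_m * 'cV[R]_n => f z.1 z.2).
Proof. by move=> z; apply: differentiable_continuous; exact: f_C1.1. Qed.

End Partial.

(** * The Lagrangian and the dual function *)

Section Lagrangian.
Context {R : realType} {dx dy p : nat}.
Variables (f : 'cV[R]_dx -> 'cV[R]_dy -> R).
Variables (A : 'M[R]_(p, dx)) (B : 'M[R]_(p, dy)) (c : 'cV[R]_p).
Local Notation Lag := (Lag f A B c).
Local Notation resid := (resid A B c).

Lemma resid_subx x x' y : resid x' y - resid x y = A *m (x' - x).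
Proof. by rewrite mulmxBr; apply/matrixP => i j; rewrite !mxE; ring. Qed.

Lemma resid_suby x y y' : resid x y' - resid x y = B *m (y' - y).
Proof. by rewrite mulmxBr; apply/matrixP => i j; rewrite !mxE; ring. Qed.

Lemma Lag_subx x x' y l :
  Lag x' y l - Lag x y l = f x' y - f x y - dotp (A^T *m l) (x' - x).
Proof. by rewrite dotp_trmx -(resid_subx x x' y) dotpBr /Lag; ring. Qed.

Lemma Lag_suby x y y' l :
  Lag x y' l - Lag x y l = f x y' - f x y - dotp (B^T *m l) (y' - y).
Proof. by rewrite dotp_trmx -(resid_suby x y y') dotpBr /Lag; ring. Qed.

Lemma Lag_subl x y l l' : Lag x y l' - Lag x y l = - dotp (l' - l) (resid x y).
Proof. by rewrite dotpBl /Lag; ring. Qed.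

Hypothesis f_C1 : C1 f.

Lemma grad_Lagx x y l : grad (fun x => Lag x y l) x = gradx f x y - A^T *m l.
Proof.
apply: (gradB_affine (k := dotp l (B *m y - c))).
  exact: C1_differentiablex.
by move=> v; rewrite dotp_trmx /Lag /resid -addrA dotpDr.
Qed.

Lemma grad_Lagy x y l : grad (fun y => Lag x y l) y = grady f x y - B^T *m l.
Proof.
apply: (gradB_affine (k := dotp l (A *m x - c))).
  exact: C1_differentiabley.
by move=> v; rewrite dotp_trmx /Lag /resid addrAC addrC dotpDr addrC.
Qed.

Lemma grad_Lagl x y l : grad (fun l => Lag x y l) l = - resid x y.
Proof.
apply: (grad_affine (k := f x y)) => v.
by rewrite dotpNl dotpC /Lag addrC.
Qed.

Variables (L mu : R) (X : set 'cV[R]_dx) (Y : set 'cV[R]_dy).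
Hypothesis f_smooth : smooth f L.

Lemma Lag_descentx x x' y l :
  `|Lag x' y l - Lag x y l - dotp (gradx f x y - A^T *m l) (x' - x)|
    <= L / 2 * enorm (x' - x) ^+ 2.
Proof.
have [sm _ _ _] := f_smooth; rewrite Lag_subx dotpBl ler_norml.
have df z := C1_differentiablex f_C1 y z.
have := descent_upper x x' df (sm y); have := descent_lower x x' df (sm y).
by rewrite /gradx => h1 h2; apply/andP; split; lra.
Qed.

Lemma Lag_descenty x y y' l :
  `|Lag x y' l - Lag x y l - dotp (grady f x y - B^T *m l) (y' - y)|
    <= L / 2 * enorm (y' - y) ^+ 2.
Proof.
have [_ _ _ sm] := f_smooth; rewrite Lag_suby dotpBl ler_norml.
have df z := C1_differentiabley f_C1 x z.
have := descent_upper y y' df (sm x); have := descent_lower y y' df (sm x).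
by rewrite /grady => h1 h2; apply/andP; split; lra.
Qed.

Hypothesis f_concave : strongly_concave_y f X Y mu.

Lemma strong_monotonicity x y y' : X x -> Y y -> Y y' ->
  mu * enorm (y' - y) ^+ 2 <= dotp (grady f x y - grady f x y') (y' - y).
Proof.
move=> Xx Yy Yy'; have := f_concave Xx Yy Yy'; have := f_concave Xx Yy' Yy.
by rewrite (enormBC y y') -(opprB y' y) dotpNr dotpBl; lra.
Qed.

(** With a second point in [Y] the function [f x] is both [mu]-strongly concave
    and [L]-smooth along a segment, which forces [mu <= L]. *)
Lemma modulus_le x y y' : X x -> Y y -> Y y' -> y != y' -> mu <= L.
Proof.
move=> Xx Yy Yy' yy'.
have [_ _ _ sm] := f_smooth.
have h := strong_monotonicity Xx Yy Yy'.
have d0 : 0 < enorm (y' - y).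
  rewrite lt_def enorm_ge0 andbT; apply: contra yy' => /eqP /enorm_eq0 /eqP.
  by rewrite subr_eq0 eq_sym.
rewrite -(@ler_pM2r _ (enorm (y' - y) ^+ 2)) ?exprn_gt0//.
apply: (le_trans h); apply: le_trans (dotp_le _ _) _.
by rewrite expr2 mulrA ler_wpM2r ?enorm_ge0// (enormBC y') sm.
Qed.

Hypothesis (Y_nonempty : Y !=set0) (Y_compact : compact Y).
Hypothesis Y_convex : convex_set Y.
Local Notation Phi := (Phi f A B c Y).

Lemma Phi_attained x l : exists ys, [/\ Y ys, Phi x l = Lag x ys l &
  forall y, Y y -> Lag x y l <= Lag x ys l].
Proof.
have cL : continuous (fun y => Lag x y l).
  have -> : (fun y => Lag x y l) =
      fun y => f x y - (dotp (B^T *m l) y + dotp l (A *m x - c)).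
    apply/funext => y.
    by rewrite dotp_trmx /Lag /resid addrAC addrC dotpDr addrC.
  move=> y; apply: (@differentiable_continuous R 'cV[R]_dy R).
  apply: differentiableB; first exact: C1_differentiabley.
  exact: differentiable_affine.
have [ys] := compact_EVT_max Y_nonempty Y_compact (continuous_subspaceT cL).
rewrite inE => Yys ms; have {}ms y : Y y -> Lag x y l <= Lag x ys l.
  by move=> Yy; apply: ms; rewrite inE.
exists ys; split => //; apply/eqP; rewrite eq_le; apply/andP; split.
  by apply: ge_sup; [exists (Lag x ys l), ys|move=> _ [y Yy <-]; exact: ms].
by apply: ub_le_sup; [exists (Lag x ys l) => _ [y Yy <-]; exact: ms|exists ys].
Qed.

Lemma Phi_ge x y l : Y y -> Lag x y l <= Phi x l.
Proof. by move=> Yy; have [ys [_ -> ]] := Phi_attained x l; exact. Qed.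

Lemma maximizer_VI x l ys y : Y ys -> Y y ->
  (forall z, Y z -> Lag x z l <= Lag x ys l) ->
  dotp (grady f x ys - B^T *m l) (y - ys) <= 0.
Proof.
move=> Yys Yy ms; apply: (@first_order_le0 _ _ (L / 2 * enorm (y - ys) ^+ 2)).
move=> t t0 t1; set z := ys + t *: (y - ys).
have Yz : Y z by apply: convex_segment_closed => //; exact: ltW.
have := Lag_descenty x ys z l; have := ms _ Yz.
rewrite /z [ys + _ - _]addrC addKr enormZ (gtr0_norm t0) dotpZr ler_norml -/z.
by move=> h1 /andP[h2 _]; lra.
Qed.

End Lagrangian.

(** * Estimates between the constants *)

Section Scalars.
Context {R : realType}.
Implicit Types a b c : R.

Lemma sqr_sum2 a b : (a + b) ^+ 2 <= 2 * a ^+ 2 + 2 * b ^+ 2.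
Proof. by have := sqr_ge0 (a - b); lra. Qed.

Lemma sqr_sum3 a b c : (a + b + c) ^+ 2 <= 3 * a ^+ 2 + 3 * b ^+ 2 + 3 * c ^+ 2.
Proof.
have := sqr_ge0 (a - b); have := sqr_ge0 (a - c); have := sqr_ge0 (b - c).
by lra.
Qed.

Lemma young a b c : 0 < c -> a * b <= a ^+ 2 / c + c / 4 * b ^+ 2.
Proof.
move=> c0; have := sqr_ge0 (a / c - b / 2); rewrite -(pmulr_rge0 _ c0).
have -> : c * (a / c - b / 2) ^+ 2 = a ^+ 2 / c + c / 4 * b ^+ 2 - a * b.
  by field; rewrite gt_eqF.
by rewrite subr_ge0.
Qed.

Variables (L mu alpha beta gamma nA nB : R).
Hypotheses (hL : 0 < L) (hmu : 0 < mu).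
Hypotheses (halpha : 0 < alpha) (hgamma : 0 < gamma) (hbeta : 3 * L < beta).
Hypothesis hnB : 0 <= nB.
Hypothesis alpha_large : alpha_bound L mu beta < alpha.
Hypothesis gamma_small : invgamma_bound L mu beta nB < gamma^-1.

Local Notation g := (gamma^-1).
Local Notation D1 := (D1_const L mu alpha beta gamma nA nB).

Let b0 : 0 < beta. Proof. by move: hL hbeta; lra. Qed.
Let Lb0 : 0 < L + beta. Proof. by rewrite addr_gt0. Qed.
Let g0 : 0 < g. Proof. by rewrite invr_gt0. Qed.

(** Half of [Num.sqrt kappa] multiplies the move of [y] in the bound on the
    distance from [y'] to the maximizer.  The conditions on [alpha] and [gamma^-1]
    involve a larger constant built on [eta], so [kappa] is what they leave room
    for. *)
Definition kappa : R := (2 * (L + beta) / mu) ^+ 2.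

Lemma kappa_ge0 : 0 <= kappa. Proof. exact: sqr_ge0. Qed.

Lemma Lkappa_ge0 : 0 <= 2 * L * kappa.
Proof. by apply: mulr_ge0 kappa_ge0; rewrite mulr_ge0// ltW. Qed.

Lemma nBkappa_ge0 : 0 <= 3 * nB ^+ 2 * kappa / L.
Proof.
apply: divr_ge0 (ltW hL); apply: mulr_ge0 kappa_ge0.
by rewrite mulr_ge0 ?sqr_ge0.
Qed.

Lemma kappa_le : kappa <= (L + beta) ^+ 2 * eta L mu beta ^+ 2 / beta ^+ 2.
Proof.
have -> : (L + beta) ^+ 2 * eta L mu beta ^+ 2 / beta ^+ 2 =
    ((L + beta) * eta L mu beta / beta) ^+ 2.
  by field; rewrite gt_eqF.
have etaE : eta L mu beta = 2 * (L + beta) / mu + (L + beta) / beta.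
  by rewrite /eta; field; rewrite !gt_eqF.
have e1 : 2 * (L + beta) / mu <= eta L mu beta.
  by rewrite etaE lerDl divr_ge0// ltW.
have k0 : 0 <= 2 * (L + beta) / mu by rewrite divr_ge0 ?mulr_ge0// ltW.
have e2 : 2 * (L + beta) / mu <= (L + beta) * eta L mu beta / beta.
  apply: (le_trans e1); rewrite mulrAC ler_peMl ?(le_trans k0 e1)//.
  by rewrite ler_pdivlMr// mul1r lerDr ltW.
by rewrite /kappa ler_pXn2r ?nnegrE// (le_trans k0).
Qed.

Lemma alpha_bound_ge : 2 * L * kappa + 4 * L <= alpha_bound L mu beta.
Proof.
rewrite /alpha_bound.
have h1 : 0 <= L ^+ 3 / (L + beta) ^+ 2 by rewrite divr_ge0 ?exprn_ge0// ltW.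
have h2 : 0 <= L ^+ 2 / mu by rewrite divr_ge0 ?exprn_ge0// ltW.
have h3 : 2 * L * kappa <=
    2 * L * (L + beta) ^+ 2 * eta L mu beta ^+ 2 / beta ^+ 2.
  by rewrite -[leRHS]mulrA -[leRHS]mulrA ler_pM2l ?mulr_gt0// mulrA kappa_le.
by lra.
Qed.

Lemma invgamma_bound_ge :
  3 * nB ^+ 2 * kappa / L <= invgamma_bound L mu beta nB.
Proof.
rewrite /invgamma_bound.
have h2 : 0 <= L ^+ 2 / mu by rewrite divr_ge0 ?exprn_ge0// ltW.
set E := (X in _ <= X + _ + _).
suff : 3 * nB ^+ 2 * kappa / L <= E by move: hL; lra.
have -> : E =
    3 * nB ^+ 2 * ((L + beta) ^+ 2 * eta L mu beta ^+ 2 / beta ^+ 2) / L.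
  by rewrite /E; field; rewrite !gt_eqF.
by rewrite ler_pM2r ?invr_gt0// ler_wpM2l ?kappa_le// mulr_ge0// sqr_ge0.
Qed.

Let m := Num.min (alpha - alpha_bound L mu beta)
    (Num.min (beta - 3 * L) (g - invgamma_bound L mu beta nB)).
Let M := Num.max (2 * beta ^+ 2 + 3 * L ^+ 2 + 3 * nB ^+ 2)
      (Num.max (3 * alpha ^+ 2 + 3 * nA ^+ 2) (3 / gamma ^+ 2)).

(** [D1] is a minimum [m] over a maximum [M], so [D1] times any argument of the
    maximum is at most any argument of the minimum; [alpha - 4 * L] and [g] are
    upper bounds for two of the latter. *)
Lemma D1_bounds : [/\ 0 < D1,
  D1 * (3 * alpha ^+ 2 + 3 * nA ^+ 2) <= beta - 3 * L,
  D1 * (3 * alpha ^+ 2 + 3 * nA ^+ 2) <= alpha - 4 * L,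
  D1 * (3 * g ^+ 2) <= beta - 3 * L
  & D1 * (3 * g ^+ 2) <= g].
Proof.
have m0 : 0 < m by rewrite !lt_min !subr_gt0 alpha_large hbeta gamma_small.
have gE : 3 / gamma ^+ 2 = 3 * g ^+ 2 by rewrite exprVn.
have M1 : 3 * alpha ^+ 2 + 3 * nA ^+ 2 <= M by rewrite !le_max lexx !orbT.
have M3 : 3 * g ^+ 2 <= M by rewrite -gE !le_max lexx !orbT.
have M0 : 0 < M.
  by apply: lt_le_trans M3; rewrite mulr_gt0// exprn_gt0.
have D0 : 0 < D1 by rewrite divr_gt0.
have D1M : D1 * M = m by rewrite divfK// gt_eqF.
have mb : m <= beta - 3 * L by rewrite !ge_min lexx !orbT.
have ma : m <= alpha - 4 * L.
  apply: (@le_trans _ _ (alpha - alpha_bound L mu beta)).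
    by rewrite ge_min lexx.
  by rewrite lerB//; apply: le_trans alpha_bound_ge; rewrite lerDr Lkappa_ge0.
have mg : m <= g.
  apply: (@le_trans _ _ (g - invgamma_bound L mu beta nB)).
    by rewrite !ge_min lexx !orbT.
  by rewrite gerBl (le_trans nBkappa_ge0)// invgamma_bound_ge.
have lift z b : z <= M -> m <= b -> D1 * z <= b.
  by move=> zM mz; apply: le_trans mz; rewrite -D1M ler_pM2l.
by split => //; exact: lift.
Qed.

(** The case [mu <= L], which holds as soon as [Y] has two points.  [X], [Y], [Z]
    stand for the lengths of the moves of [x], [y], [l], [ex] and [ey] for the
    estimation errors, [D] for the distance from [y'] to the maximizer, [dS] for
    the variation of the potential and [G2] for the squared gap. *)
Section Estimates.
Hypothesis mu_le : mu <= L.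

(** From [kappa * mu ^+ 2 = 4 * (L + beta) ^+ 2], [mu <= L] and
    [4 * L <= L + beta]. *)
Lemma kappa_bounds :
  [/\ 64 <= kappa, 64 * L <= kappa * mu & 12 * beta <= L * kappa].
Proof.
have kE : kappa * mu ^+ 2 = 4 * (L + beta) ^+ 2.
  by rewrite /kappa; field; rewrite gt_eqF.
have mu2 : mu ^+ 2 <= L ^+ 2 by rewrite ler_pXn2r ?nnegrE// ltW.
have muL : mu ^+ 2 <= L * mu by rewrite expr2 ler_pM2r.
have LL : 16 * L ^+ 2 <= (L + beta) ^+ 2.
  have -> : 16 * L ^+ 2 = (4 * L) ^+ 2 by ring.
  rewrite ler_pXn2r ?nnegrE ?mulr_ge0// ?ltW//; move: hbeta; lra.
have k0 := kappa_ge0.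
have mu20 : 0 < mu ^+ 2 by rewrite exprn_gt0.
have L20 : 0 < L ^+ 2 by rewrite exprn_gt0.
have k1 : 4 * (L + beta) ^+ 2 <= kappa * L ^+ 2.
  by rewrite -kE ler_wpM2l.
split.
- by rewrite -(ler_pM2r L20); lra.
- rewrite -(ler_pM2r hmu) -[leRHS]mulrA -expr2 kE.
  have : L * mu <= L ^+ 2 by rewrite expr2 ler_pM2l.
  by lra.
- rewrite -(ler_pM2r hL).
  have -> : L * kappa * L = kappa * L ^+ 2 by ring.
  apply: le_trans k1.
  have : 0 <= beta * (beta - 3 * L) by rewrite mulr_ge0 ?subr_ge0// ltW.
  by have := sqr_ge0 L; have : 0 < L * beta by [rewrite mulr_gt0]; lra.
Qed.

Variables (X Y Z ex ey D dS G2 : R).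
Hypotheses (hX : 0 <= X) (hY : 0 <= Y) (hZ : 0 <= Z) (hey : 0 <= ey).
Hypothesis D_le : mu * D <= L * X + nB * Z + (L + beta) * Y + ey.
Hypothesis dS_le : dS <= - alpha * X ^+ 2 + ex * X - beta * Y ^+ 2 + ey * Y
  - g * Z ^+ 2 + 3 / 2 * L * X ^+ 2 + L / 2 * Y ^+ 2 + 2 * (L * X + nB * Z) * D.

(** Inserting the bound on [D] produces [u ^+ 2] and the product [u * w], where
    [u = L * X + nB * Z] and [w = Y + ey / (L + beta)].  Young's inequality is
    weighted so that [w] costs only [L * Y ^+ 2], because the slack in [beta] does
    not involve [kappa]; the factor [kappa] goes to [X] and [Z], whose step sizes
    have room for it. *)
Lemma coupling_le : 2 * (L * X + nB * Z) * D <=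
  17 / 16 * (L * kappa * X ^+ 2 + nB ^+ 2 * kappa / L * Z ^+ 2)
  + L * Y ^+ 2 + L / (L + beta) ^+ 2 * ey ^+ 2.
Proof.
set u := L * X + nB * Z; set e' := ey / (L + beta); pose w := Y + e'.
have L0 := ltW hL.
have u0 : 0 <= u by rewrite addr_ge0// mulr_ge0.
have w0 : 0 <= w by rewrite addr_ge0// divr_ge0// ltW.
pose a := 2 * (L + beta) / mu.
have aE : kappa = a ^+ 2 by [].
have [_ kmu _] := kappa_bounds.
have D1' : D <= u / mu + a / 2 * w.
  rewrite -(ler_pM2l hmu).
  have -> : mu * (u / mu + a / 2 * w) = u + (L + beta) * Y + ey.
    by rewrite /a /w /e'; field; rewrite !gt_eqF.
  exact: D_le.
have h1 : 2 * u * D <= 2 * u * (u / mu + a / 2 * w).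
  by rewrite ler_wpM2l// mulr_ge0.
have h2 : 2 * u * (u / mu + a / 2 * w) = 2 / mu * u ^+ 2 + (a * u) * w.
  by field; rewrite gt_eqF.
have h3 : (a * u) * w <= (a * u) ^+ 2 / (2 * L) + (2 * L) / 4 * w ^+ 2.
  by apply: young; rewrite mulr_gt0.
have h4 : w ^+ 2 <= 2 * Y ^+ 2 + 2 * e' ^+ 2 by exact: sqr_sum2.
have h5 : u ^+ 2 <= 2 * (L * X) ^+ 2 + 2 * (nB * Z) ^+ 2 by exact: sqr_sum2.
have h6 : 2 / mu <= kappa / (32 * L).
  rewrite ler_pdivlMr ?mulr_gt0// mulrAC ler_pdivrMr//; move: kmu; lra.
have h7 : 2 / mu * u ^+ 2 <= kappa / (32 * L) * u ^+ 2.
  by rewrite ler_wpM2r ?sqr_ge0.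
(* 17 / 32 = 1 / 32 + 1 / 2: the two coefficients of kappa / L * u ^+ 2 coming
   from h7 and from h3. *)
have c0 : 0 <= 17 / 32 * (kappa / L).
  by rewrite mulr_ge0 ?divr_ge0 ?kappa_ge0// ltW.
have h8 := ler_wpM2l c0 h5.
have h9 : 17 / 32 * (kappa / L) * u ^+ 2 =
    kappa / (32 * L) * u ^+ 2 + (a * u) ^+ 2 / (2 * L).
  by rewrite exprMn -aE; field; rewrite gt_eqF.
have h10 : 17 / 32 * (kappa / L) * (2 * (L * X) ^+ 2 + 2 * (nB * Z) ^+ 2) =
   17 / 16 * (L * kappa * X ^+ 2 + nB ^+ 2 * kappa / L * Z ^+ 2).
  by field; rewrite gt_eqF.
have h11 : L / (L + beta) ^+ 2 * ey ^+ 2 = L * e' ^+ 2.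
  by rewrite /e'; field; rewrite gt_eqF.
have h12 : (2 * L) / 4 * w ^+ 2 <= L * Y ^+ 2 + L * e' ^+ 2.
  have /(ler_wpM2l (ltW hL)) := h4; lra.
by rewrite h11; lra.
Qed.

(** As [2 * L * kappa + 4 * L <= alpha] and [3 * nB ^+ 2 * kappa / L <= g], the
    coupling leaves fixed fractions of [alpha] and of [g]. *)
Lemma potential_descent :
  dS <= - (alpha / 3) * X ^+ 2 - (beta - 3 * L) * Y ^+ 2 - g / 2 * Z ^+ 2
  + ex ^+ 2 / L + (1 / (2 * L) + L / (L + beta) ^+ 2) * ey ^+ 2.
Proof.
have hc := coupling_le.
have h1 := young ex X hL.
have h2 : ey * Y <= ey ^+ 2 / (2 * L) + (2 * L) / 4 * Y ^+ 2.
  by apply: young; rewrite mulr_gt0.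
have X2 := sqr_ge0 X; have Y2 := sqr_ge0 Y; have Z2 := sqr_ge0 Z.
have LX2 : 0 <= L * X ^+ 2 by rewrite mulr_ge0// ltW.
have LY2 : 0 <= L * Y ^+ 2 by rewrite mulr_ge0// ltW.
have aX : (2 * L * kappa + 4 * L) * X ^+ 2 <= alpha * X ^+ 2.
  by rewrite ler_wpM2r// (le_trans alpha_bound_ge)// ltW.
have gZ : 3 * nB ^+ 2 * kappa / L * Z ^+ 2 <= g * Z ^+ 2.
  by rewrite ler_wpM2r// (le_trans invgamma_bound_ge)// ltW.
have aX0 : 0 <= alpha * X ^+ 2 by rewrite mulr_ge0// ltW.
have gZ0 : 0 <= g * Z ^+ 2 by rewrite mulr_ge0// ltW.
have e1 : 1 / (2 * L) * ey ^+ 2 = ey ^+ 2 / (2 * L) by rewrite mulrAC mul1r.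
by rewrite [(_ + _) * ey ^+ 2]mulrDl e1; move: dS_le; lra.
Qed.

Hypothesis G2_le : G2 <= (beta * Y + ey) ^+ 2 + ((alpha * X + L * Y + ex) ^+ 2
  + (g * Z + nA * X + nB * Y) ^+ 2).

(** The factor 2 in front of [D1] has to be earned in each of the three moves.
    For [X], [D1 * (3 * alpha ^+ 2)] is at most [beta], which is at most
    [alpha / 24] by [kappa_bounds].  For [Z], the geometric mean of
    [3 * alpha ^+ 2] and [3 * g ^+ 2] is at most the maximum in [D1], so
    [D1 * (3 * g) <= beta / alpha <= 1 / 24].  For [Y], the entry of that maximum
    belonging to [y] is less than half of the larger of the two others. *)
Lemma gap_potential : 2 * D1 * G2 <= - dS + (6 * D1 + 1 / L) * ex ^+ 2
  + (4 * D1 + 1 / (2 * L) + L / (L + beta) ^+ 2) * ey ^+ 2.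
Proof.
have [D0 hM1 _ hM3 _] := D1_bounds.
have [k64 _ kb] := kappa_bounds.
have ag : 2 * L * kappa + 4 * L <= alpha.
  by rewrite (le_trans alpha_bound_ge)// ltW.
have gg : 3 * nB ^+ 2 * kappa / L <= g.
  by rewrite (le_trans invgamma_bound_ge)// ltW.
have ab : 24 * beta <= alpha by move: hL; lra.
have X2 := sqr_ge0 X; have Y2 := sqr_ge0 Y; have Z2 := sqr_ge0 Z.
have D3ag : D1 * (3 * alpha * g) <= beta - 3 * L.
  have : 0 <= D1 * (alpha - g) ^+ 2 by rewrite mulr_ge0 ?sqr_ge0// ltW.
  have : 0 <= D1 * nA ^+ 2 by rewrite mulr_ge0 ?sqr_ge0// ltW.
  by lra.
have hx : 2 * (D1 * (3 * alpha ^+ 2 + 3 * nA ^+ 2)) <= alpha / 3.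
  by move: hL b0; lra.
have hz : 2 * (D1 * (3 * g ^+ 2)) <= g / 2.
  have h : D1 * (3 * (24 * beta) * g) <= D1 * (3 * alpha * g).
    by rewrite ler_pM2l// ler_pM2r// ler_pM2l.
  have h' : D1 * (3 * 24) * g <= 1.
    rewrite -(ler_pM2l b0) mulr1; move: hL; lra.
  have : D1 * (3 * 24) * g * g <= 1 * g by rewrite ler_pM2r.
  by move: g0; lra.
have hy : 2 * (D1 * (2 * beta ^+ 2 + 3 * L ^+ 2 + 3 * nB ^+ 2)) <=
    beta - 3 * L.
  have n1 : 18 * 64 * nB ^+ 2 <= 3 * alpha * g.
    have : (2 * L * kappa) * (3 * nB ^+ 2 * kappa / L) <= alpha * g.
      apply: ler_pM => //.
      - exact: Lkappa_ge0.
      - exact: nBkappa_ge0.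
      - by move: ag hL; lra.
    have -> : (2 * L * kappa) * (3 * nB ^+ 2 * kappa / L) =
        6 * nB ^+ 2 * kappa ^+ 2.
      by field; rewrite gt_eqF.
    have : 6 * nB ^+ 2 * 64 <= 6 * nB ^+ 2 * kappa ^+ 2.
      rewrite ler_wpM2l ?mulr_ge0 ?sqr_ge0//.
      rewrite (le_trans k64)// expr2 ler_peMr ?kappa_ge0//.
      by move: k64; lra.
    by lra.
  have n2 : 2 * beta ^+ 2 + 3 * L ^+ 2 <= 3 * beta ^+ 2.
    have : (3 * L) ^+ 2 <= beta ^+ 2.
      by rewrite ler_pXn2r ?nnegrE ?mulr_ge0// ltW.
    by have := sqr_ge0 beta; lra.
  have n3 : (24 * beta) ^+ 2 <= alpha ^+ 2.
    by rewrite ler_pXn2r ?nnegrE ?mulr_ge0// ltW.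
  have q1 := ler_wpM2l (ltW D0) n1; have q2 := ler_wpM2l (ltW D0) n2.
  have q3 := ler_wpM2l (ltW D0) n3.
  have : 0 <= D1 * nA ^+ 2 by rewrite mulr_ge0 ?sqr_ge0// ltW.
  have : 0 <= D1 * nB ^+ 2 by rewrite mulr_ge0 ?sqr_ge0// ltW.
  have : 0 <= D1 * beta ^+ 2 by rewrite mulr_ge0 ?sqr_ge0// ltW.
  by lra.
have hx' := ler_wpM2r X2 hx; have hy' := ler_wpM2r Y2 hy.
have hz' := ler_wpM2r Z2 hz.
have hG : D1 * G2 <= D1 * ((2 * beta ^+ 2 + 3 * L ^+ 2 + 3 * nB ^+ 2) * Y ^+ 2
    + (3 * alpha ^+ 2 + 3 * nA ^+ 2) * X ^+ 2 + 3 * g ^+ 2 * Z ^+ 2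
    + 2 * ey ^+ 2 + 3 * ex ^+ 2).
  rewrite ler_pM2l//; apply: (le_trans G2_le).
  have := sqr_sum2 (beta * Y) ey; have := sqr_sum3 (alpha * X) (L * Y) ex.
  have := sqr_sum3 (g * Z) (nA * X) (nB * Y).
  by rewrite !exprMn; lra.
have := potential_descent.
have e1 : ex ^+ 2 / L = 1 / L * ex ^+ 2 by rewrite mul1r mulrC.
by rewrite e1; lra.
Qed.

End Estimates.

(** The case of a one-point set [Y]: there is no move of [y] and no distance to
    the maximizer, and [mu] may exceed [L]. *)
Section SingletonEstimates.
Variables (X Z ex dS G2 : R).
Hypothesis dS_le : dS <= - alpha * X ^+ 2 + ex * X - g * Z ^+ 2
  + 3 / 2 * L * X ^+ 2.
Hypothesis G2_le : G2 <= (alpha * X + ex) ^+ 2 + (g * Z + nA * X) ^+ 2.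

(** Each block of the gap is now a sum of two terms, so splitting its square costs
    a factor 2 instead of 3, and [4 / 3 * 2 < 3]. *)
Lemma gap_potential_singleton :
  4 / 3 * D1 * G2 <= - dS + 4 / 3 * (3 * D1 + 1 / L) * ex ^+ 2.
Proof.
have [D0 _ hM1 _ hM3] := D1_bounds.
have X2 := sqr_ge0 X; have Z2 := sqr_ge0 Z; have e2 := sqr_ge0 ex.
have h1 := young ex X hL.
have hG : D1 * G2 <= D1 * ((2 * alpha ^+ 2 + 2 * nA ^+ 2) * X ^+ 2
    + 2 * g ^+ 2 * Z ^+ 2 + 2 * ex ^+ 2).
  rewrite ler_pM2l//; apply: (le_trans G2_le).
  have := sqr_sum2 (alpha * X) ex; have := sqr_sum2 (g * Z) (nA * X).
  by rewrite !exprMn; lra.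
have hx' := ler_wpM2r X2 hM1; have hz' := ler_wpM2r Z2 hM3.
have LX2 : 0 <= L * X ^+ 2 by rewrite mulr_ge0// ltW.
have aX2 : 0 <= alpha * X ^+ 2 by rewrite mulr_ge0// ltW.
have gZ2 : 0 <= g * Z ^+ 2 by rewrite mulr_ge0// ltW.
have D2 : 0 <= D1 * ex ^+ 2 by rewrite mulr_ge0// ltW.
have L2 : 0 <= 1 / L * ex ^+ 2 by rewrite mulr_ge0 ?divr_ge0// ltW.
have e1 : ex ^+ 2 / L = 1 / L * ex ^+ 2 by rewrite mul1r mulrC.
by rewrite e1 in h1; move: dS_le; lra.
Qed.

End SingletonEstimates.
End Scalars.

(** * The cone of multipliers and the infimum of the potential *)

Section Multipliers.
Context {R : realType} {p : nat} (s : sense).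
Local Notation Lam := (@Lam R p s).

Lemma Lam_projectable : projectable Lam.
Proof.
split=> [z w t|v].
  case: s => //= z0 w0 t0 t1 i; rewrite !mxE.
  have -> : z i 0 + t * (w i 0 - z i 0) = (1 - t) * z i 0 + t * w i 0 by ring.
  by rewrite addr_ge0// mulr_ge0// subr_ge0.
case: s => /=; last first.
  by exists v; split => // w _; rewrite subrr enorm0 enorm_ge0.
exists (\col_i Num.max 0 (v i 0)); split => [i|w w0].
  by rewrite mxE le_max lexx.
rewrite /enorm ler_wsqrtr//; apply: ler_sum => i _; rewrite !mxE -!expr2.
have [v0|v0] := leP 0 (v i 0); first by rewrite subrr expr0n sqr_ge0.
by have := w0 i; nra.
Qed.

Lemma Lam_add_delta (l : 'cV[R]_p) i : Lam l -> Lam (l + delta_mx i 0).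
Proof. by case: s => //= l0 j; rewrite !mxE addr_ge0. Qed.

Lemma proj_Lam_ge (v : 'cV[R]_p) i : v i 0 <= proj Lam v i 0.
Proof.
have pL := Lam_projectable.
have := proj_VI pL v (Lam_add_delta i (proj_in pL v)).
by rewrite [_ + _ - _]addrC addKr dotp_delta !mxE subr_le0.
Qed.

(** Moving the [i]-th coordinate of a projected multiplier upwards stays inside
    both cones, so the multiplier block of the gap dominates every violated
    constraint, whatever the sense of the constraints. *)
Lemma violation_le_multiplier_gap (gamma : R) (l r : 'cV[R]_p) i : 0 < gamma ->
  Num.max 0 (r i 0) <= enorm (gamma^-1 *: (l - proj Lam (l + gamma *: r))).
Proof.
move=> g0; rewrite ge_max enorm_ge0 /=.
apply: le_trans (coord_le_enorm _ i); rewrite -normrN.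
apply: le_trans (ler_norm _); rewrite !mxE -mulrN opprB.
have := proj_Lam_ge (l + gamma *: r) i; rewrite !mxE => h.
by rewrite mulrC ler_pdivlMr// mulrC; lra.
Qed.

Lemma dotp_Lam_feasible {dx dy : nat} (A : 'M[R]_(p, dx)) (B : 'M[R]_(p, dy)) c
  x y l : Lam l -> feasible A B c s x y -> dotp l (resid A B c x y) <= 0.
Proof.
rewrite /Defs.Lam /feasible; case: s => /= [l0 r0|_ ->].
  by apply: sumr_le0 => i _; rewrite mulr_ge0_le0.
by rewrite -(scale0r (0 : 'cV_p)) dotpZr mul0r.
Qed.

End Multipliers.

Section Infimum.
Context {R : realType}.

Lemma inf_image_ge T (D : set T) (g : T -> R) m : D !=set0 ->
  (forall t, D t -> m <= g t) -> m <= inf [set g t | t in D].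
Proof.
move=> [t Dt] mg; apply: lb_le_inf; first by exists (g t), t.
by move=> _ [u Du <-]; exact: mg.
Qed.

Lemma inf_image_le T (D : set T) (g : T -> R) m t :
  (forall t, D t -> m <= g t) -> D t -> inf [set g t | t in D] <= g t.
Proof.
move=> mg Dt; apply: ge_inf; last by exists t.
by exists m => _ [u Du <-]; exact: mg.
Qed.

Context {dx dy p : nat}.
Variables (f : 'cV[R]_dx -> 'cV[R]_dy -> R).
Variables (A : 'M[R]_(p, dx)) (B : 'M[R]_(p, dy)) (c : 'cV[R]_p) (s : sense).
Variables (X : set 'cV[R]_dx) (Y : set 'cV[R]_dy).
Hypotheses (X_nonempty : X !=set0) (X_compact : compact X).
Hypotheses (Y_nonempty : Y !=set0) (Y_compact : compact Y).
Hypothesis hfeas : forall x, X x -> exists2 y, Y y & feasible A B c s x y.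
Hypothesis f_C1 : C1 f.
Local Notation Lam := (@Lam R p s).
Local Notation Spot := (Spot f A B c Y).

(** Weak duality: for a feasible [yf] the dual value [Phi x l] is at least
    [f x yf], and [f] is bounded below on the compact set [X `*` Y]. *)
Lemma Spot_bounded_below : exists m, forall x y l, X x -> Y y -> Lam l ->
  m <= Spot x y l.
Proof.
have XY0 : (X `*` Y) !=set0.
  by have [x Xx] := X_nonempty; have [y Yy] := Y_nonempty; exists (x, y).
have [z _ mz] := compact_EVT_min XY0 (compact_setX X_compact Y_compact)
  (continuous_subspaceT (C1_continuous f_C1)).
exists (f z.1 z.2) => x y l Xx Yy Ll.
have [yf Yyf yfP] := hfeas Xx.
have h1 := Phi_ge A B c f_C1 Y_nonempty Y_compact x l Yy.
have h2 := Phi_ge A B c f_C1 Y_nonempty Y_compact x l Yyf.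
have h3 := dotp_Lam_feasible Ll yfP.
have h4 : f z.1 z.2 <= f x yf by apply: (mz (x, yf)); rewrite inE.
by move: h1 h2 h3 h4; rewrite /Defs.Spot {2}/Lag; lra.
Qed.

(** The infimum of an unbounded set of reals would be meaningless, so a uniform
    lower bound is carried through the three nested infima. *)
Lemma S_inf_le x y l : X x -> Y y -> Lam l -> S_inf f A B c s X Y <= Spot x y l.
Proof.
move=> Xx Yy Ll; have [m hm] := Spot_bounded_below.
have h1 x1 l1 : X x1 -> Lam l1 -> m <= inf [set Spot x1 y l1 | y in Y].
  by move=> ? ?; apply: inf_image_ge => // y1 ?; exact: hm.
have h2 l1 : Lam l1 ->
    m <= inf [set inf [set Spot x y l1 | y in Y] | x in X].
  by move=> ?; apply: inf_image_ge => // x1 ?; exact: h1.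
apply: le_trans (inf_image_le (fun y Yy => hm x y l Xx Yy Ll) Yy).
apply: le_trans (inf_image_le (fun x Xx => h1 x l Xx Ll) Xx).
exact: (inf_image_le h2 Ll).
Qed.

End Infimum.

(** * One iteration *)

Lemma smoothing_sqr (R : realType) (eps D theta w : R) : 0 < D -> 0 < w ->
  theta = eps * Num.sqrt D / Num.sqrt w -> theta ^+ 2 * w = eps ^+ 2 * D.
Proof.
move=> D0 w0 ->; rewrite exprMn exprMn exprVn !sqr_sqrtr ?(ltW D0) ?(ltW w0)//.
by rewrite divfK// gt_eqF.
Qed.

(** One iteration from [(x, y, l)] to [(x', y', l')] driven by estimates [hx] and
    [hy] of the partial gradients of [f]; that they are difference quotients
    matters only for the size of their errors. *)
Section Step.
Context {R : realType} {dx dy p : nat}.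
Variables (f : 'cV[R]_dx -> 'cV[R]_dy -> R).
Variables (A : 'M[R]_(p, dx)) (B : 'M[R]_(p, dy)) (c : 'cV[R]_p) (s : sense).
Variables (X : set 'cV[R]_dx) (Y : set 'cV[R]_dy) (L mu : R).
Hypotheses (X_nonempty : X !=set0) (X_convex : convex_set X).
Hypothesis X_compact : compact X.
Hypotheses (Y_nonempty : Y !=set0) (Y_convex : convex_set Y).
Hypothesis Y_compact : compact Y.
Hypotheses (hL : 0 < L) (hmu : 0 < mu).
Hypotheses (f_C1 : C1 f) (f_smooth : smooth f L).
Hypothesis f_concave : strongly_concave_y f X Y mu.
Variables (alpha beta gamma : R).
Hypotheses (halpha : 0 < alpha) (hbeta : 0 < beta) (hgamma : 0 < gamma).

Local Notation Lam := (@Lam R p s).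
Local Notation resid := (resid A B c).
Local Notation Lag := (Lag f A B c).
Local Notation Phi := (Phi f A B c Y).
Local Notation Spot := (Spot f A B c Y).

Variables (x x' : 'cV[R]_dx) (y y' : 'cV[R]_dy) (l l' : 'cV[R]_p).
Variables (hx : 'cV[R]_dx) (hy : 'cV[R]_dy).
Hypotheses (Xx : X x) (Yy : Y y) (Ll : Lam l).
Hypothesis y'E : y' = proj Y (y + beta^-1 *: (hy - B^T *m l)).
Hypothesis x'E : x' = proj X (x - alpha^-1 *: (hx - A^T *m l)).
Hypothesis l'E : l' = proj Lam (l + gamma *: resid x' y').

Let pX : projectable X := compact_projectable X_nonempty X_compact X_convex.
Let pY : projectable Y := compact_projectable Y_nonempty Y_compact Y_convex.
Let pL : projectable Lam := Lam_projectable s.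

Local Notation ex := (enorm (hx - gradx f x y')).
Local Notation ey := (enorm (hy - grady f x y)).
Local Notation Dx := (enorm (x' - x)).
Local Notation Dy := (enorm (y' - y)).
Local Notation Dl := (enorm (l' - l)).

Lemma step_in : [/\ X x', Y y' & Lam l'].
Proof. by rewrite x'E y'E l'E; split; exact: proj_in. Qed.

(** The distance from the new [y'] to the maximizer [ys] at the new point [x']
    and [l'] comes from adding three inequalities: strong monotonicity of the
    [y]-gradient, optimality of [ys], and optimality of the projection defining
    [y']. *)
Lemma maximizer_distance ys : Y ys ->
  (forall z, Y z -> Lag x' z l' <= Lag x' ys l') ->
  mu * enorm (ys - y') <= L * Dx + opnorm B * Dl + (L + beta) * Dy + ey.
Proof.
move=> Yys ms; have [Xx' Yy' _] := step_in.
set w := ys - y'.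
have [w0|w0] := eqVneq (enorm w) 0.
  by rewrite w0 mulr0 !addr_ge0 ?mulr_ge0 ?addr_ge0 ?enorm_ge0 ?opnorm_ge0// ltW.
have wp : 0 < enorm w by rewrite lt_def w0 enorm_ge0.
rewrite -(ler_pM2r wp) -mulrA -expr2.
have h1 := strong_monotonicity f_concave Xx' Yy' Yys.
have h2 := maximizer_VI f_C1 f_smooth Y_convex Yys Yy' ms.
have h3 := proj_step_VI pY hbeta y'E Yys.
have [_ _ smx smy] := f_smooth.
have b1 : dotp (grady f x' y' - grady f x y') w <= L * Dx * enorm w.
  by apply: le_trans (dotp_le _ _) _; rewrite ler_wpM2r ?enorm_ge0// smx.
have b2 : dotp (grady f x y' - grady f x y) w <= L * Dy * enorm w.
  by apply: le_trans (dotp_le _ _) _; rewrite ler_wpM2r ?enorm_ge0// smy.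
have b3 : - dotp (hy - grady f x y) w <= ey * enorm w.
  by rewrite -dotpNl; apply: le_trans (dotp_le _ _) _; rewrite enormN.
have b4 : dotp (y' - y) w <= Dy * enorm w by exact: dotp_le.
have b5 : - dotp (B^T *m (l' - l)) w <= opnorm B * Dl * enorm w.
  rewrite dotp_trmx -dotpNl; apply: le_trans (dotp_le _ _) _.
  by rewrite enormN mulrAC [leRHS]mulrC ler_wpM2l ?enorm_ge0// opnorm_le.
have b4' : beta * dotp (y' - y) w <= beta * (Dy * enorm w) by rewrite ler_pM2l.
rewrite mulmxBr dotpBl in b5; rewrite dotpBl in b1; rewrite dotpBl in b2.
rewrite dotpBl in b3; rewrite dotpBl in h1.
rewrite -/w -(opprB y' y) scalerN dotpBl dotpBl dotpZl in h3.
rewrite -(opprB ys y') dotpNr dotpBl in h2.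
by rewrite !mulrDl; lra.
Qed.

(** The maximizer [ys] at the new point is a competitor in the maximum defining
    [Phi x l], which bounds the increase of [Phi] by differences of the Lagrangian
    at the fixed [ys].  These enter twice and [Lag] once with the opposite sign,
    so after moving from [ys] to [y'] one copy of the products with the gradients
    at [y'] is left, which the projections turn into negative squares. *)
Lemma potential_step ys : Y ys -> Phi x' l' = Lag x' ys l' ->
  Spot x' y' l' - Spot x y l <=
    - alpha * Dx ^+ 2 + ex * Dx - beta * Dy ^+ 2 + ey * Dy - gamma^-1 * Dl ^+ 2
    + 3 / 2 * L * Dx ^+ 2 + L / 2 * Dy ^+ 2
    + 2 * (L * Dx + opnorm B * Dl) * enorm (ys - y').
Proof.
move=> Yys PhiE; have [Xx' Yy' Ll'] := step_in.
have P := Phi_ge A B c f_C1 Y_nonempty Y_compact x l Yys.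
have := Lag_descentx A B c f_C1 f_smooth x x' ys l.
rewrite ler_norml => /andP[_ h2].
have h3 := Lag_subl f A B c x' ys l l'.
have h4 := resid_suby A B c x' y' ys.
have [_ smx _ _] := f_smooth.
have h5 : dotp (gradx f x ys - gradx f x y') (x' - x) <=
    L * enorm (ys - y') * Dx.
  by apply: le_trans (dotp_le _ _) _; rewrite ler_wpM2r ?enorm_ge0// smx.
have h6 : - dotp (l' - l) (B *m (ys - y')) <= opnorm B * Dl * enorm (ys - y').
  rewrite -dotpNl; apply: le_trans (dotp_le _ _) _.
  rewrite enormN [X in _ <= X * _]mulrC -mulrA.
  by rewrite ler_wpM2l ?enorm_ge0// opnorm_le.
have := Lag_descenty A B c f_C1 f_smooth x y y' l.
rewrite ler_norml => /andP[h7 _].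
have := Lag_descentx A B c f_C1 f_smooth x x' y' l.
rewrite ler_norml => /andP[h8 _].
have h9 := Lag_subl f A B c x' y' l l'.
have h10 : alpha * Dx ^+ 2 <= dotp (- (hx - A^T *m l)) (x' - x).
  by apply: (proj_step_ascent pX halpha) => //; rewrite scalerN.
have h11 := proj_step_ascent pY hbeta y'E Yy.
have h12 : gamma^-1 * Dl ^+ 2 <= dotp (resid x' y') (l' - l).
  by apply: (proj_step_ascent pL) => //; rewrite ?invr_gt0// invrK.
have e1 : - dotp (hx - gradx f x y') (x' - x) <= ex * Dx.
  by rewrite -dotpNl; apply: le_trans (dotp_le _ _) _; rewrite enormN.
have e2 : dotp (hy - grady f x y) (y' - y) <= ey * Dy by exact: dotp_le.
have h13 : dotp (l' - l) (resid x' ys) =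
    dotp (l' - l) (resid x' y') + dotp (l' - l) (B *m (ys - y')).
  by rewrite -h4 dotpBr; ring.
move: h2 h5 h7 h8 h10 h11 e1 e2; rewrite [dotp (resid _ _) _]dotpC in h12.
rewrite /Defs.Spot PhiE.
set vx := x' - x; set vy := y' - y; rewrite !dotpNl !dotpBl.
by lra.
Qed.

Local Notation gap := (gap f A B c s X Y alpha beta gamma x y l).

Lemma gap_sqr : enorm gap ^+ 2 =
  enorm (alpha *: (x - proj X (x - alpha^-1 *: (gradx f x y - A^T *m l)))) ^+ 2
  + (enorm (beta *: (y - proj Y (y + beta^-1 *: (grady f x y - B^T *m l)))) ^+ 2
  + enorm (gamma^-1 *: (l - proj Lam (l + gamma *: resid x y))) ^+ 2).
Proof.
rewrite /Defs.gap enorm_col_mx enorm_col_mx.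
rewrite (grad_Lagx A B c f_C1 x y l) (grad_Lagy A B c f_C1 x y l).
by rewrite (grad_Lagl f A B c x y l) scalerN opprK.
Qed.

(** The next iterate is the same projection taken at the estimated gradient, and
    nonexpansiveness turns the discrepancy into the estimation error. *)
Lemma gapy_le :
  enorm (beta *: (y - proj Y (y + beta^-1 *: (grady f x y - B^T *m l))))
    <= beta * Dy + ey.
Proof.
set q := proj Y _; have -> : y - q = (y - y') + (y' - q) by rewrite subrKA.
rewrite scalerDr; apply: le_trans (enormD _ _) _.
rewrite !enormZ gtr0_norm// (enormBC y) lerD2l.
rewrite -ler_pdivlMl// {1}y'E; apply: le_trans (proj_nonexpansive pY _ _) _.
rewrite opprD addrACA subrr add0r -scalerBr opprB addrA subrK.
by rewrite enormZ gtr0_norm// invr_gt0.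
Qed.

Lemma gapx_le :
  enorm (alpha *: (x - proj X (x - alpha^-1 *: (gradx f x y - A^T *m l))))
    <= alpha * Dx + L * Dy + ex.
Proof.
have [_ smx _ _] := f_smooth.
set q := proj X _; have -> : x - q = (x - x') + (x' - q) by rewrite subrKA.
rewrite scalerDr; apply: le_trans (enormD _ _) _.
rewrite !enormZ gtr0_norm// (enormBC x) -addrA lerD2l.
rewrite -ler_pdivlMl// {1}x'E; apply: le_trans (proj_nonexpansive pX _ _) _.
rewrite opprD addrACA subrr add0r -opprD enormN -scalerBr opprB addrA subrK.
rewrite enormZ gtr0_norm ?invr_gt0// ler_pM2l ?invr_gt0//.
have -> : hx - gradx f x y =
    (gradx f x y' - gradx f x y) + (hx - gradx f x y').
  by rewrite [RHS]addrC subrKA.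
by apply: le_trans (enormD _ _) _; rewrite lerD2r smx.
Qed.

Lemma gapl_le :
  enorm (gamma^-1 *: (l - proj Lam (l + gamma *: resid x y)))
    <= gamma^-1 * Dl + opnorm A * Dx + opnorm B * Dy.
Proof.
set q := proj Lam _; have -> : l - q = (l - l') + (l' - q) by rewrite subrKA.
rewrite scalerDr; apply: le_trans (enormD _ _) _.
rewrite !enormZ gtr0_norm ?invr_gt0// (enormBC l) -addrA lerD2l.
rewrite ler_pdivrMl// {1}l'E; apply: le_trans (proj_nonexpansive pL _ _) _.
rewrite opprD addrACA subrr add0r -scalerBr enormZ gtr0_norm// ler_pM2l//.
have -> : resid x' y' - resid x y = A *m (x' - x) + B *m (y' - y).
  by rewrite -(resid_subx _ B c _ _ y) -(resid_suby A _ c x') [RHS]addrC subrKA.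
by apply: le_trans (enormD _ _) _; rewrite lerD// opnorm_le.
Qed.

Variables (D1 eps theta1 theta2 : R).
Hypothesis beta_large : 3 * L < beta.
Hypothesis alpha_large : alpha_bound L mu beta < alpha.
Hypothesis gamma_small : invgamma_bound L mu beta (opnorm B) < gamma^-1.
Hypothesis D1E : D1 = D1_const L mu alpha beta gamma (opnorm A) (opnorm B).
Hypotheses (htheta1 : 0 < theta1) (htheta2 : 0 < theta2).
Hypothesis hxE : hx = zgradx f theta1 x y'.
Hypothesis hyE : hy = zgrady f theta2 x y.
Hypothesis theta1_sqr :
  theta1 ^+ 2 * (dx%:R * L * (3 * D1 * L + 1)) = eps ^+ 2 * D1.
Hypothesis theta2_sqr :
  theta2 ^+ 2 * (2 * D1 * dy%:R * L ^+ 2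
    + ((L + beta) ^+ 2 + 4 * L ^+ 2) * dy%:R * L / (2 * (L + beta) ^+ 2))
  = eps ^+ 2 * D1.
Hypothesis heps : 0 < eps.

Let D1_gt0 : 0 < D1.
Proof.
by rewrite D1E; have [] :=
  D1_bounds (opnorm A) hL hmu hgamma beta_large alpha_large gamma_small.
Qed.

Let Lb0 : 0 < L + beta. Proof. by rewrite addr_gt0. Qed.

(** The smoothing parameters are chosen so that each of the two weighted errors
    consumes at most half of [eps ^+ 2 * D1]. *)
Lemma error_budgetx : (6 * D1 + 2 / L) * ex ^+ 2 <= eps ^+ 2 * D1 / 2.
Proof.
have [sm _ _ _] := f_smooth.
have df z : differentiable (f ^~ y') z by exact: C1_differentiablex.
have h : ex ^+ 2 <= dx%:R * L ^+ 2 * theta1 ^+ 2 / 4.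
  by rewrite hxE; exact: (forward_difference_error x htheta1 df (sm y')).
apply: (@le_trans _ _ ((6 * D1 + 2 / L) * (dx%:R * L ^+ 2 * theta1 ^+ 2 / 4))).
  by rewrite ler_wpM2l// addr_ge0 ?mulr_ge0 ?invr_ge0// ltW.
rewrite -theta1_sqr le_eqVlt; apply/orP; left; apply/eqP.
by field; rewrite gt_eqF.
Qed.

Lemma error_budgety :
  (4 * D1 + 1 / L + 4 * L / (L + beta) ^+ 2) * ey ^+ 2 <= eps ^+ 2 * D1 / 2.
Proof.
have [_ _ _ sm] := f_smooth.
have df z : differentiable (f x) z by exact: C1_differentiabley.
have h : ey ^+ 2 <= dy%:R * L ^+ 2 * theta2 ^+ 2 / 4.
  by rewrite hyE; exact: (forward_difference_error y htheta2 df (sm x)).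
apply: (@le_trans _ _ ((4 * D1 + 1 / L + 4 * L / (L + beta) ^+ 2)
    * (dy%:R * L ^+ 2 * theta2 ^+ 2 / 4))).
  rewrite ler_wpM2l//.
  have h1 : 0 <= 4 * D1 by rewrite mulr_ge0// ltW.
  have h2 : 0 <= 1 / L by rewrite divr_ge0// ltW.
  have h3 : 0 <= 4 * L / (L + beta) ^+ 2.
    by rewrite divr_ge0 ?sqr_ge0// mulr_ge0// ltW.
  by rewrite !addr_ge0.
rewrite -theta2_sqr le_eqVlt; apply/orP; left; apply/eqP.
by field; rewrite !gt_eqF.
Qed.

Let D1_sqr_le : eps < enorm gap -> D1 * eps ^+ 2 <= D1 * enorm gap ^+ 2.
Proof.
move=> h; rewrite ler_pM2l// ler_pXn2r ?nnegrE ?enorm_ge0// ?(ltW heps)//.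
exact: ltW.
Qed.

Lemma decrease_nontrivial : mu <= L -> eps < enorm gap ->
  D1 * eps ^+ 2 <= Spot x y l - Spot x' y' l'.
Proof.
move=> muL /D1_sqr_le Deg.
have [_ Yy' _] := step_in.
have [ys [Yys PhiE ms]] := Phi_attained A B c f_C1 Y_nonempty Y_compact x' l'.
have hdist := maximizer_distance Yys ms.
have hpot := potential_step Yys PhiE.
have hG2 : enorm gap ^+ 2 <= (beta * Dy + ey) ^+ 2
    + ((alpha * Dx + L * Dy + ex) ^+ 2
    + (gamma^-1 * Dl + opnorm A * Dx + opnorm B * Dy) ^+ 2).
  rewrite gap_sqr addrCA.
  apply: lerD; last apply: lerD.
  - exact: enorm_sqr_le gapy_le.
  - exact: enorm_sqr_le gapx_le.
  - exact: enorm_sqr_le gapl_le.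
have := gap_potential hL hmu halpha hgamma beta_large (opnorm_ge0 B)
  alpha_large gamma_small muL (enorm_ge0 _) (enorm_ge0 _) (enorm_ge0 _)
  (enorm_ge0 _) hdist hpot hG2.
have bx := error_budgetx; have bey := error_budgety.
have p1 : 0 <= L^-1 * ex ^+ 2 by rewrite mulr_ge0 ?sqr_ge0// invr_ge0 ltW.
have p2 : 0 <= L^-1 * ey ^+ 2 by rewrite mulr_ge0 ?sqr_ge0// invr_ge0 ltW.
have p3 : 0 <= L / (L + beta) ^+ 2 * ey ^+ 2.
  by rewrite mulr_ge0 ?sqr_ge0// divr_ge0 ?sqr_ge0// ltW.
have -> : 1 / (2 * L) = L^-1 / 2 by field; rewrite gt_eqF.
rewrite -D1E; move: bx bey p1 p2 p3 Deg.
by set S := Spot x y l; set S' := Spot x' y' l'; lra.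
Qed.

Lemma decrease_singleton : (forall z w, Y z -> Y w -> z = w) ->
  eps < enorm gap -> D1 * eps ^+ 2 <= Spot x y l - Spot x' y' l'.
Proof.
move=> Yeq /D1_sqr_le Deg.
have [_ Yy' _] := step_in.
have [ys [Yys PhiE ms]] := Phi_attained A B c f_C1 Y_nonempty Y_compact x' l'.
have hpot := potential_step Yys PhiE.
have yy : y' - y = 0 by rewrite (Yeq _ _ Yy' Yy) subrr.
have ysy : ys - y' = 0 by rewrite (Yeq _ _ Yys Yy') subrr.
have hG2 : enorm gap ^+ 2 <=
    (alpha * Dx + ex) ^+ 2 + (gamma^-1 * Dl + opnorm A * Dx) ^+ 2.
  have := gapx_le; have := gapl_le.
  rewrite yy enorm0 !mulr0 !addr0 gap_sqr => hl2 hx2.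
  have -> : y - proj Y (y + beta^-1 *: (grady f x y - B^T *m l)) = 0.
    by rewrite (Yeq _ _ (proj_in pY _) Yy) subrr.
  rewrite scaler0 enorm0 expr0n add0r; apply: lerD.
  - exact: enorm_sqr_le hx2.
  - exact: enorm_sqr_le hl2.
have {}hpot : Spot x' y' l' - Spot x y l <=
    - alpha * Dx ^+ 2 + ex * Dx - gamma^-1 * Dl ^+ 2 + 3 / 2 * L * Dx ^+ 2.
  by move: hpot; rewrite yy ysy !enorm0; lra.
have := gap_potential_singleton hL hmu halpha hgamma beta_large alpha_large
  gamma_small hpot hG2.
have bx := error_budgetx.
rewrite -D1E; move: bx Deg.
by set S := Spot x y l; set S' := Spot x' y' l'; lra.
Qed.

Lemma potential_decrease : eps < enorm gap ->
  D1 * eps ^+ 2 <= Spot x y l - Spot x' y' l'.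
Proof.
have [[y1 [y2 [Yy1 Yy2 y12]]]|Ysub] :=
  pselect (exists y1 y2, [/\ Y y1, Y y2 & y1 != y2]).
  apply: decrease_nontrivial.
  exact: (modulus_le f_smooth f_concave Xx Yy1 Yy2).
apply: decrease_singleton => z w Yz Yw; apply/eqP.
by apply: contra_notT Ysub => zw; exists z, w.
Qed.

End Step.

(** * Complexity bound *)

Theorem theorem2p12 (R : realType) (dx dy p : nat)
  (hdx : (0 < dx)%N) (hdy : (0 < dy)%N)
  (f : 'cV[R]_dx -> 'cV[R]_dy -> R)
  (A : 'M[R]_(p, dx)) (B : 'M[R]_(p, dy)) (c : 'cV[R]_p) (s : sense)
  (X : set 'cV[R]_dx) (Y : set 'cV[R]_dy)
  (X_nonempty : X !=set0) (X_convex : convex_set X) (X_compact : compact X)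
  (Y_nonempty : Y !=set0) (Y_convex : convex_set Y) (Y_compact : compact Y)
  (hfeas : forall x, X x -> exists2 y, Y y & feasible A B c s x y)
  (hslater : slater A B c s X Y)
  (L mu : R) (hL : 0 < L) (hmu : 0 < mu)
  (f_C1 : C1 f) (f_smooth : smooth f L)
  (f_concave : strongly_concave_y f X Y mu)
  (alpha beta gamma theta1 theta2 eps : R)
  (halpha : 0 < alpha) (hbeta : 0 < beta) (hgamma : 0 < gamma)
  (htheta1 : 0 < theta1) (htheta2 : 0 < theta2) (heps : 0 < eps)
  (beta_large : 3 * L < beta)
  (alpha_large : alpha_bound L mu beta < alpha)
  (gamma_small : invgamma_bound L mu beta (opnorm B) < gamma^-1)
  (D1 : R)
  (D1E : D1 = D1_const L mu alpha beta gamma (opnorm A) (opnorm B))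
  (theta1E : theta1 =
     eps * Num.sqrt D1 / Num.sqrt (dx%:R * L * (3 * D1 * L + 1)))
  (theta2E : theta2 =
     eps * Num.sqrt D1 /
       Num.sqrt (2 * D1 * dy%:R * L ^+ 2
                 + ((L + beta) ^+ 2 + 4 * L ^+ 2) * dy%:R * L
                   / (2 * (L + beta) ^+ 2)))
  (x : nat -> 'cV[R]_dx) (y : nat -> 'cV[R]_dy) (l : nat -> 'cV[R]_p)
  (iter : zo_pdapg f A B c s X Y alpha beta gamma theta1 theta2 x y l)
  (D2 : R)
  (D2E : D2 = Spot f A B c Y (x 1%N) (y 1%N) (l 1%N) - S_inf f A B c s X Y) :
  exists T : nat,
    [/\ is_first (fun k =>
          enorm (gap f A B c s X Y alpha beta gamma (x k) (y k) (l k)) <= eps) T,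
        (1 < T)%N -> T%:R <= 2 * D2 / (eps ^+ 2 * D1)
      & forall i, Num.max 0 (resid A B c (x T) (y T) i 0) <= eps].
Proof.
pose G k := enorm (gap f A B c s X Y alpha beta gamma (x k) (y k) (l k)).
pose S k := Spot f A B c Y (x k) (y k) (l k).
have D1_gt0 : 0 < D1.
  by rewrite D1E; have [] :=
    D1_bounds (opnorm A) hL hmu hgamma beta_large alpha_large gamma_small.
have [X1 Y1 L1 step] := iter.
have inP k : (0 < k)%N -> [/\ X (x k), Y (y k) & Lam s (l k)].
  case: k => // -[|k] _; first by split.
  have [yE xE lE] := step k.+1 isT.
  exact: (step_in X_nonempty X_convex X_compact Y_nonempty Y_convex Y_compact
    yE xE lE).
have th1 := smoothing_sqr D1_gt0 _ theta1E.
have th2 := smoothing_sqr D1_gt0 _ theta2E.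
have {}th1 : theta1 ^+ 2 * (dx%:R * L * (3 * D1 * L + 1)) = eps ^+ 2 * D1.
  by apply: th1; rewrite !mulr_gt0 ?ltr0n// addr_gt0// !mulr_gt0.
have {}th2 : theta2 ^+ 2 * (2 * D1 * dy%:R * L ^+ 2
   + ((L + beta) ^+ 2 + 4 * L ^+ 2) * dy%:R * L / (2 * (L + beta) ^+ 2))
   = eps ^+ 2 * D1.
  apply: th2.
  have dy0 : 0 < dy%:R :> R by rewrite ltr0n.
  have h1 : 0 < 2 * D1 * dy%:R * L ^+ 2 by rewrite !mulr_gt0// exprn_gt0.
  have h2 : 0 < ((L + beta) ^+ 2 + 4 * L ^+ 2) * dy%:R * L
      / (2 * (L + beta) ^+ 2).
    by rewrite divr_gt0 ?mulr_gt0 ?addr_gt0 ?mulr_gt0 ?exprn_gt0 ?addr_gt0.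
  by rewrite addr_gt0.
have descent k : (0 < k)%N -> eps < G k -> D1 * eps ^+ 2 <= S k - S k.+1.
  move=> k0; have [Xk Yk Lk] := inP k k0; have [yE xE lE] := step k k0.
  exact: (potential_decrease X_nonempty X_convex X_compact Y_nonempty Y_convex
    Y_compact hL hmu f_C1 f_smooth f_concave halpha hbeta hgamma Xk Yk Lk yE xE
    lE beta_large alpha_large gamma_small D1E htheta1 htheta2 erefl erefl th1
    th2 heps).
have total N : (forall k, (0 < k <= N)%N -> eps < G k) ->
    N%:R * (D1 * eps ^+ 2) <= S 1%N - S N.+1.
  elim: N => [|N IH] h; first by rewrite mul0r subrr.
  have := descent N.+1 isT (h N.+1 _); rewrite leqnn => /(_ isT).
  have : N%:R * (D1 * eps ^+ 2) <= S 1%N - S N.+1.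
    by apply: IH => k /andP[k0 kN]; apply: h; rewrite k0 leqW.
  by rewrite -natr1; lra.
have total' N : (forall k, (0 < k <= N)%N -> eps < G k) ->
    N%:R * (D1 * eps ^+ 2) <= D2.
  move=> /total h; apply: (le_trans h); rewrite D2E lerB//.
  have [XN YN LN] := inP N.+1 isT.
  exact: (S_inf_le X_nonempty X_compact Y_nonempty Y_compact).
have De0 : 0 < D1 * eps ^+ 2 by rewrite mulr_gt0// exprn_gt0.
have exT : exists k, (0 < k)%N && (G k <= eps).
  apply: contrapT => noT.
  have /total' : forall k,
      (0 < k <= Num.bound `|D2 / (D1 * eps ^+ 2)|)%N -> eps < G k.
    move=> k /andP[k0 _]; rewrite ltNge; apply/negP => Gk.
    by apply: noT; exists k; rewrite k0.
  apply/negP; rewrite -ltNge -ltr_pdivrMr//.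
  by rewrite (le_lt_trans (ler_norm _))// archi_boundP.
case: (ex_minnP exT) => T /andP[T0 GT] minT.
exists T; split.
- by split => // k k0 Gk; apply: minT; rewrite k0.
- case: T T0 GT minT => // -[|N] // _ _ minT _.
  have /total' h : forall k, (0 < k <= N.+1)%N -> eps < G k.
    move=> k /andP[k0 kN]; rewrite ltNge; apply/negP => Gk.
    by have := minT k; rewrite k0 Gk => /(_ isT); rewrite ltnNge kN.
  rewrite [eps ^+ 2 * D1]mulrC ler_pdivlMr//.
  (* T = N + 2 and N + 1 steps are bounded, hence T <= 2 * (N + 1). *)
  have N0 : 0 <= N%:R * (D1 * eps ^+ 2) by rewrite mulr_ge0// ltW.
  by move: h; rewrite -!natr1; lra.
- move=> i; apply: le_trans GT.
  apply: (le_trans (violation_le_multiplier_gap s (l T) _ i hgamma)).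
  rewrite -(@ler_pXn2r _ 2) ?nnegrE ?enorm_ge0//.
  rewrite (gap_sqr A B c s X Y f_C1 alpha beta gamma (x T) (y T) (l T)) addrA.
  by rewrite lerDr addr_ge0 ?sqr_ge0.
Qed.
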